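(* Let $U:\mathbb{R}\to\mathbb{S}^1\subset\mathbb{R}^2$ be defined by $$U(x)=\begin{pmatrix}\frac{x^2-1}{x^2+1}\\[2pt] \frac{-2x}{x^2+1}\end{pmatrix}.$$ Consider the linearized half-harmonic map equation at $U$: for $v:\mathbb{R}\to\mathbb{R}^2$ with $v(x)\cdot U(x)=0$ for all $x\in\mathbb{R}$, $$(-\Delta_{\mathbb{R}})^{1/2}v(x)=\left(\frac{1}{2\pi}\int_{\mathbb{R}}\frac{|U(x)-U(y)|^2}{|x-y|^2}\,dy\right)v(x)+\left(\frac{1}{\pi}\int_{\mathbb{R}}\frac{(U(x)-U(y))\cdot(v(x)-v(y))}{|x-y|^2}\,dy\right)U(x)\quad\text{in }\mathbb{R}.$$ Then every bounded solution $v$ of this equation is a linear combination (with real coefficients) of $$Z_1(x)=\begin{pmatrix}\frac{2x}{x^2+1}\\[2pt] \frac{x^2-1}{x^2+1}\end{pmatrix},\quad Z_2(x)=\begin{pmatrix}\frac{-4x}{(x^2+1)^2}\\[2pt] \frac{2(1-x^2)}{(x^2+1)^2}\end{pmatrix},\quad Z_3(x)=\begin{pmatrix}\frac{-4x^2}{(x^2+1)^2}\\[2pt] \frac{2x(1-x^2)}{(x^2+1)^2}\end{pmatrix}.$$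
   Context: $(-\Delta_{\mathbb{R}})^{1/2}$ denotes the half-Laplacian on $\mathbb{R}$, acting componentwise, given by $(-\Delta_{\mathbb{R}})^{1/2}f(x)=\frac{1}{\pi}\,\mathrm{P.V.}\int_{\mathbb{R}}\frac{f(x)-f(y)}{|x-y|^2}\,dy$. The map $U$ is a half-harmonic map, i.e. a solution of $(-\Delta_{\mathbb{R}})^{1/2}u=\left(\frac{1}{2\pi}\int_{\mathbb{R}}\frac{|u(x)-u(y)|^2}{|x-y|^2}dy\right)u$ with values in $\mathbb{S}^1$; the functions $Z_1,Z_2,Z_3$ arise from rotation, translation and dilation of $U$ respectively. The tangency condition $v(x)\cdot U(x)=0$ means $v$ takes values in $T_{U(x)}\mathbb{S}^1$. *)

(* Defs.v *)
From HB Require Import structures.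
From mathcomp Require Import all_boot all_order all_algebra.
From mathcomp Require Import all_classical all_reals all_analysis.
Set Implicit Arguments. Unset Strict Implicit. Unset Printing Implicit Defensive.
Import Order.TTheory GRing.Theory Num.Theory.
Import numFieldNormedType.Exports.
Local Open Scope classical_set_scope.
Local Open Scope ring_scope.

Section Defs.
Variable R : realType.

Definition U1 (x : R) : R := (x ^+ 2 - 1) / (x ^+ 2 + 1).
Definition U2 (x : R) : R := (- 2 * x) / (x ^+ 2 + 1).

Definition Z11 (x : R) : R := (2 * x) / (x ^+ 2 + 1).
Definition Z12 (x : R) : R := (x ^+ 2 - 1) / (x ^+ 2 + 1).
Definition Z21 (x : R) : R := (- 4 * x) / (x ^+ 2 + 1) ^+ 2.
Definition Z22 (x : R) : R := (2 * (1 - x ^+ 2)) / (x ^+ 2 + 1) ^+ 2.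
Definition Z31 (x : R) : R := (- 4 * x ^+ 2) / (x ^+ 2 + 1) ^+ 2.
Definition Z32 (x : R) : R := (2 * x * (1 - x ^+ 2)) / (x ^+ 2 + 1) ^+ 2.

Definition trunc_int (g : R -> R) (x eps : R) : R :=
  Rintegral (@lebesgue_measure R) [set y : R | eps < `|x - y|] g.

Definition PV_at (g : R -> R) (x L : R) : Prop :=
  trunc_int g x @ (0:R)^'+ --> L.

Definition hl_kernel (f : R -> R) (x : R) : R -> R :=
  fun y => (f x - f y) / (x - y) ^+ 2.

Definition energy_density (x : R) : R -> R :=
  fun y => ((U1 x - U1 y) ^+ 2 + (U2 x - U2 y) ^+ 2) / (x - y) ^+ 2.

Definition cross_kernel (v1 v2 : R -> R) (x : R) : R -> R :=
  fun y => ((U1 x - U1 y) * (v1 x - v1 y) + (U2 x - U2 y) * (v2 x - v2 y))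
           / (x - y) ^+ 2.

(* v = (v1,v2) solves the linearized half-harmonic map equation at x:
   (-Delta)^{1/2} v (x) = (1/(2 pi) \int |U(x)-U(y)|^2/|x-y|^2 dy) v(x)
                        + (1/pi \int (U(x)-U(y)).(v(x)-v(y))/|x-y|^2 dy) U(x),
   where (-Delta)^{1/2} f (x) = (1/pi) P.V. \int (f(x)-f(y))/|x-y|^2 dy. *)
Definition solves_linearized_at (v1 v2 : R -> R) (x : R) : Prop :=
  exists L1 L2 M : R,
    [/\ PV_at (hl_kernel v1 x) x L1,
        PV_at (hl_kernel v2 x) x L2,
        PV_at (cross_kernel v1 v2 x) x M,
        L1 / pi = (Rintegral (@lebesgue_measure R) setT (energy_density x)
                     / (2 * pi)) * v1 x + (M / pi) * U1 x
      & L2 / pi = (Rintegral (@lebesgue_measure R) setT (energy_density x)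
                     / (2 * pi)) * v2 x + (M / pi) * U2 x].

End Defs.

(* Main.v *)
(** A tangent field is v = phi Z_1 with phi scalar, and the system becomes
    PV int (phi(x) - phi(y)) / (x - y)^2 dy = 2 / (1 + x^2) (pi phi(x) - c)
    at every point x, with c = int phi(y) / (1 + y^2) dy.

    Let u(x, t) be the Poisson extension of phi. Abel summation of the truncated
    integrals turns the principal value into the pointwise normal derivative of u.
    To make it locally uniform, let F(x) = int_0^1 u(x, s) ds, whose Poisson
    difference quotients converge at each x with error O(t); the constant is uniform,
    the range of t is not.
    If F + La x^2 failed to be convex, a parabola would touch F from above and
    contradict this rate; convexity of F + La x^2 and of La x^2 - F in turn gives
    |phi(x) - u(x, t)| <= B t uniformly, and hence, by dominated convergence, the
    equation tested against all translates and dilates of the Poisson kernel and of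
    its conjugate.

    On the disc the tested equation says that r d/dr u = u - mean on the interior.
    Along the hyperbolic geodesic from i to a boundary point p, with
    q = (1 - r) / (1 + r), it is an ODE which makes (u - c) (1 + q) / (1 - q) constant.
    Comparing q -> 0 (the value phi(p)) with q -> 1 (the gradient at the centre)
    writes phi(p) as a combination of 1, (1 - p^2) / (1 + p^2) and p / (1 + p^2). *)

Require Import Defs.
From HB Require Import structures.
From mathcomp Require Import all_boot all_order all_algebra.
From mathcomp Require Import all_classical all_reals all_analysis.
From mathcomp Require Import measurable_realfun.
From mathcomp Require Import ring lra.
Import Order.TTheory GRing.Theory Num.Theory.
Import numFieldNormedType.Exports.
Local Open Scope classical_set_scope.
Local Open Scope ring_scope.
Set Implicit Arguments.
Unset Strict Implicit.
Unset Printing Implicit Defensive.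

(** The obstacle is regularity: phi is only bounded and measurable, the equation holds point by
    point, and neither continuity of phi nor any uniformity of its principal values is given.
    Pairing the equation with a test function exchanges the limit t -> 0 with an integral, and
    pointwise normal derivatives come without a majorant; the bound B t supplies it. The maximum
    principle is run on F because F is continuous, so that maxima are attained, and because the
    semigroup law expresses the Poisson quotients of F at x through height integrals of u at the
    same x. The test functions mix the Poisson kernel with its conjugate since multiplying a Poisson
    kernel by 1 + y^2, which cancels the weight of the equation, gives such a mixture plus a
    constant. The relation r d/dr u = u - mean leaves only Fourier modes of degree 0 and 1, whence
    dimension three. Integrating along single radii reaches this without Fourier series: u - mean is
    a multiple of r on each radius, and the multiple can be read off at either end. *)

Section derivative_rules.
Context {R : realType}.
Implicit Types (f g : R -> R) (x df dg c : R).

Lemma der_id x : is_derive x (1 : R) (fun y : R => y) 1.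
Proof. exact: is_derive_id. Qed.

Lemma der_cst c x : is_derive x (1 : R) (fun=> c) 0.
Proof. exact: is_derive_cst. Qed.

Lemma der_add f g x df dg : is_derive x (1 : R) f df ->
  is_derive x (1 : R) g dg -> is_derive x (1 : R) (fun y => f y + g y) (df + dg).
Proof. exact: is_deriveD. Qed.

Lemma der_opp f x df : is_derive x (1 : R) f df ->
  is_derive x (1 : R) (fun y => - f y) (- df).
Proof. exact: is_deriveN. Qed.

Lemma der_mul f g x df dg : is_derive x (1 : R) f df ->
  is_derive x (1 : R) g dg ->
  is_derive x (1 : R) (fun y => f y * g y) (df * g x + f x * dg).
Proof.
move=> hf hg; apply: (is_derive_eq (is_deriveM hf hg)).
by rewrite /GRing.scale /= addrC (mulrC df).
Qed.

Lemma der_inv f x df : is_derive x (1 : R) f df -> f x != 0 ->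
  is_derive x (1 : R) (fun y => (f y)^-1) (- df / f x ^+ 2).
Proof.
move=> hf f0; apply: (is_derive_eq (is_deriveV f0 hf)).
by rewrite /GRing.scale /= mulNr mulrC mulNr.
Qed.

Lemma der_exp f x df n : is_derive x (1 : R) f df ->
  is_derive x (1 : R) (fun y => f y ^+ n) (n%:R * f x ^+ n.-1 * df).
Proof.
move=> hf; rewrite (_ : (fun _ => _) = f ^+ n); last by apply/funext => y; rewrite fctE.
by apply: (is_derive_eq (is_deriveX n hf)); rewrite /GRing.scale.
Qed.

Lemma der_ln f x df : is_derive x (1 : R) f df -> 0 < f x ->
  is_derive x (1 : R) (fun y => ln (f y)) (df / f x).
Proof.
move=> hf f0; apply: (is_derive_eq (is_derive1_comp (is_derive1_ln f0) hf)).
by rewrite mulrC.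
Qed.

Lemma der_atan f x df : is_derive x (1 : R) f df ->
  is_derive x (1 : R) (fun y => atan (f y)) (df / (1 + f x ^+ 2)).
Proof.
move=> hf; apply: (is_derive_eq (is_derive1_comp (is_derive1_atan (f x)) hf)).
by rewrite mulrC.
Qed.

End derivative_rules.

(** * Integration on the line *)

Section integration_on_the_line.
Context {R : realType}.
Notation mu := (@lebesgue_measure R).
Notation ig f := (mu.-integrable setT (EFin \o f)).
Notation I f := (Rintegral mu setT f).
Implicit Types (f g F : R -> R) (a b k l t : R).

Lemma ig_measurable f : ig f -> measurable_fun setT f.
Proof. by move=> /integrableP[/measurable_EFinP]. Qed.

Lemma ig_le f g : measurable_fun setT f -> ig g ->
  (forall x, `|f x| <= g x) -> ig f.
Proof.
move=> mf hg fg; apply: le_integrable hg => //; first exact/measurable_EFinP.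
by move=> x _ /=; rewrite lee_fin (le_trans (fg x)) ?ler_norm.
Qed.

Lemma igD f g : ig f -> ig g -> ig (fun x => f x + g x).
Proof. by move=> /= hf hg; exact: (integrableD measurableT hf hg). Qed.

Lemma igB f g : ig f -> ig g -> ig (fun x => f x - g x).
Proof. by move=> /= hf hg; exact: (integrableB measurableT hf hg). Qed.

Lemma igZ k f : ig f -> ig (fun x => k * f x).
Proof. by move=> /= hf; exact: (integrableZl measurableT k hf). Qed.

Lemma ig_norm f : ig f -> ig (fun x => `|f x|).
Proof. by move=> /integrable_norm. Qed.

Lemma igM_bounded f g k : measurable_fun setT f -> (forall x, `|f x| <= k) ->
  ig g -> ig (fun x => f x * g x).
Proof.
move=> mf fk hg; apply: (@ig_le _ (fun x => k * `|g x|)).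
- by apply: measurable_funM => //; exact: ig_measurable.
- exact/igZ/ig_norm.
- by move=> x; rewrite normrM ler_wpM2r.
Qed.

Lemma ID f g : ig f -> ig g -> I (fun x => f x + g x) = I f + I g.
Proof. exact: RintegralD. Qed.

Lemma IB f g : ig f -> ig g -> I (fun x => f x - g x) = I f - I g.
Proof. exact: RintegralB. Qed.

Lemma IZ k f : ig f -> I (fun x => k * f x) = k * I f.
Proof. exact: RintegralZl. Qed.

Lemma I_le f g : ig f -> ig g -> (forall x, f x <= g x) -> I f <= I g.
Proof. by move=> hf hg fg; apply: le_Rintegral. Qed.

Lemma I_norm_le f g : ig f -> ig g -> (forall x, `|f x| <= g x) ->
  `|I f| <= I g.
Proof.
move=> hf hg fg; apply: (le_trans (le_normr_Rintegral measurableT hf)).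
by apply: I_le => //; exact: ig_norm.
Qed.

Lemma I_ext f g : f =1 g -> I f = I g.
Proof. by move=> fg; apply: eq_Rintegral => x _. Qed.

Lemma ig_ext f g : f =1 g -> ig f -> ig g.
Proof. by move=> fg; apply: eq_integrable => // x _; rewrite /= fg. Qed.

Lemma ae_neq (a : R) (P : R -> Prop) : (forall x, x != a -> P x) ->
  {ae mu, forall x, P x}.
Proof.
move=> aP; exists [set a]; split => //; first exact: lebesgue_measure_set1.
by move=> x /= nPx; apply: contrapT => /eqP xa; exact/nPx/aP.
Qed.

(** Kernels with denominator (x - y)^2 take the default value 0 at y = x, so closed forms agree with
    them only off the diagonal. *)
Lemma I_ext_except a f g : measurable_fun setT f -> measurable_fun setT g ->
  (forall x, x != a -> f x = g x) -> I f = I g.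
Proof.
move=> mf mg fg; congr fine; apply: ae_eq_integral => //.
- exact/measurable_EFinP.
- exact/measurable_EFinP.
- apply: (@ae_neq a (fun x => setT x -> (f x)%:E = (g x)%:E)) => x xa _.
  by rewrite fg.
Qed.

Lemma measurable_invr : measurable_fun setT (@GRing.inv R).
Proof.
rewrite -(setUv [set 0 : R]); apply/measurable_funU => //.
  exact: measurableC.
split; first exact: measurable_fun_set1.
apply: open_continuous_measurable_fun.
  by apply: closed_openC; exact: closed_eq.
by move=> x /set_mem /= /eqP x0; exact: inv_continuous.
Qed.

Lemma dominated_cvgR (f_ : nat -> R -> R) f g :
  (forall n, measurable_fun setT (f_ n)) ->
  (forall x, f_ n x @[n --> \oo] --> f x) -> ig g ->
  (forall n x, `|f_ n x| <= g x) ->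
  ig f /\ I (f_ n) @[n --> \oo] --> I f.
Proof.
move=> mf fcv hg fg.
have mf0 : measurable_fun setT f.
  by apply: (measurable_fun_cvg (h := f_)) => // x _; exact: fcv.
have [|||||h1 _ h2] := @dominated_convergence _ _ _ mu _ measurableT
  (fun n => EFin \o f_ n) (EFin \o f) (EFin \o g).
- by move=> n; have /measurable_EFinP := mf n; exact.
- by have /measurable_EFinP := mf0; exact.
- by apply: aeW => x _; apply: cvg_EFin; [exact: nearW|exact: fcv].
- exact: hg.
- by apply: aeW => x n _ /=; rewrite lee_fin.
split=> //; apply: fine_cvg; rewrite fineK //.
exact: integrable_fin_num.
Qed.

Lemma measurable_restrictR (D : set R) f : measurable D ->
  measurable_fun setT f -> measurable_fun setT (f \_ D).
Proof.
move=> mD mf; have [h _] := measurable_restrictT f mD.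
by apply: h; exact: measurable_funTS.
Qed.

Lemma cvg_opp_natr : (fun n : nat => - (n%:R : R)) n @[n --> \oo] --> -oo.
Proof.
apply/cvgNry; rewrite (_ : - _ = fun n : nat => n%:R); first exact: cvgr_idn.
by apply/funext => n; rewrite !fctE opprK.
Qed.

End integration_on_the_line.

(** * Fundamental theorem of calculus on the line, mass of the Poisson kernel *)

Section fundamental_theorem.
Context {R : realType}.
Notation mu := (@lebesgue_measure R).
Notation ig f := (mu.-integrable setT (EFin \o f)).
Notation I f := (Rintegral mu setT f).
Implicit Types (f g F : R -> R) (a b k l m r s t : R).

Lemma Rintegral_FTC f F a b : a <= b -> continuous f ->
  (forall x : R, is_derive x (1 : R) F (f x)) ->
  Rintegral mu `[a, b] f = F b - F a.
Proof.
rewrite le_eqVlt => /predU1P[-> _ _|ab cf dF].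
  by rewrite set_itv1 Rintegral_set1 subrr.
have cF : continuous F.
  move=> x; apply: differentiable_continuous; apply/derivable1_diffP.
  exact: ex_derive.
rewrite /Rintegral (@continuous_FTC2 _ _ F)//.
- exact: continuous_subspaceT.
- split; first by move=> x _; exact: ex_derive.
  + exact/cvg_at_right_filter/cF.
  + exact/cvg_at_left_filter/cF.
- by move=> x _; rewrite derive1E; exact: derive_val.
Qed.

Lemma Rintegral_FTC_line f F l m : continuous f -> ig f ->
  (forall x : R, is_derive x (1 : R) F (f x)) ->
  F x @[x --> +oo] --> l -> F x @[x --> -oo] --> m -> I f = l - m.
Proof.
move=> cf hf dF Fl Fm.
pose f_ n : R -> R := f \_ `[- n%:R, n%:R].
have mf := ig_measurable hf.
have [||||_ h] := @dominated_cvgR _ f_ f (fun x => `|f x|).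
- by move=> n; exact: measurable_restrictR.
- move=> x; apply: cvg_near_cst; near=> n; rewrite /f_ patchE mem_set //=.
  rewrite in_itv/= -ler_norml; near: n; exact: nbhs_infty_ger.
- exact: ig_norm.
- by move=> n x; rewrite /f_ patchE; case: ifP => // _; rewrite normr0.
have h2 : (fun n : nat => F n%:R - F (- n%:R)) n @[n --> \oo] --> l - m.
  apply: cvgB.
    by move/cvg_pinftyP : Fl; apply; exact: cvgr_idn.
  by move/cvg_ninftyP : Fm; apply; exact: cvg_opp_natr.
have h' : (fun n => I (f_ n)) n @[n --> \oo] --> l - m.
  apply: cvg_trans h2; apply: near_eq_cvg; near=> n.
  rewrite -(@Rintegral_FTC f)//; first by rewrite Rintegral_mkcond.
  by rewrite -subr_ge0 opprK addr_ge0.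
by rewrite -(cvg_lim _ h') // (cvg_lim _ h).
Unshelve. all: by end_near. Qed.

Lemma ig_ge0 f r : measurable_fun setT f -> (forall x, 0 <= f x) ->
  (\int[mu]_x (f x)%:E = r%:E)%E -> ig f /\ I f = r.
Proof.
move=> mf f0 e; split; last by rewrite /Rintegral e.
apply/integrableP; split; first by have /measurable_EFinP := mf; exact.
under eq_fun => x do rewrite /= ger0_norm //.
by rewrite e ltry.
Qed.

Lemma ig_oneDsqrV : ig (fun y => (1 + y ^+ 2)^-1) /\
  I (fun y => (1 + y ^+ 2)^-1) = pi.
Proof.
have e : (\int[mu]_x ((1 + x ^+ 2)^-1)%:E = pi%:E)%E.
  rewrite (@ge0_symfun_integralT _ (fun x => (oneDsqr x)^-1)).
  - rewrite -set_itvcy integral0y_oneDsqr -EFinM; congr EFin; by field.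
  - by move=> x; rewrite invr_ge0.
  - exact: continuous_oneDsqrV.
  - by move=> x /=; rewrite /oneDsqr sqrrN.
apply: ig_ge0 e; first by apply: continuous_measurable_fun; exact: continuous_oneDsqrV.
by move=> x; rewrite invr_ge0 addr_ge0 ?sqr_ge0.
Qed.

Lemma poisson_integral a s : 0 < s ->
  ig (fun y => s / ((y - a) ^+ 2 + s ^+ 2)) /\
  I (fun y => s / ((y - a) ^+ 2 + s ^+ 2)) = pi.
Proof.
move=> s0; pose G : R -> R := fun y => (1 + y ^+ 2)^-1.
pose S : R -> R := fun y => (y - a) / s.
have dS y : is_derive y (1 : R) S s^-1.
  apply: (is_derive_eq (der_mul (der_add (der_id y) (der_cst (- a) y)) (der_cst s^-1 y))).
  by ring.
have dS1 : derive1 S = cst s^-1.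
  by apply/funext => y; rewrite derive1E derive_val.
have e : (\int[mu]_x (s / ((x - a) ^+ 2 + s ^+ 2))%:E = pi%:E)%E.
  have <- : (\int[mu]_x (G x)%:E = pi%:E)%E.
    have [h <-] := ig_oneDsqrV; rewrite /Rintegral fineK //.
    exact: (integrable_fin_num measurableT h).
  have cG : continuous G by exact: continuous_oneDsqrV.
  have Soo : S y @[y --> +oo] --> +oo.
    apply: gt0_cvgMly; first by rewrite invr_gt0.
    exact: cvg_addrr.
  have SNoo : S y @[y --> -oo] --> -oo.
    apply: gt0_cvgMlNy; first by rewrite invr_gt0.
    exact: cvg_addrr_Ny.
  rewrite (@increasing_ge0_integration_by_substitutionT _ S G) //.
  - apply: eq_integral => y _ /=; congr EFin.
    rewrite !fctE dS1 /G /S /=; field.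
    by rewrite (gt_eqF s0) gt_eqF // ltr_pwDl ?sqr_ge0 ?exprn_gt0.
  - by move=> x y xy; rewrite /S ltr_pM2r ?invr_gt0// ltrD2r.
  - by rewrite dS1; exact: cst_continuous.
  - by rewrite dS1; exact: is_cvg_cst.
  - by rewrite dS1; exact: is_cvg_cst.
  - by move=> x; rewrite invr_ge0 addr_ge0 ?sqr_ge0.
apply: ig_ge0 e; last first.
  by move=> x; rewrite divr_ge0 ?addr_ge0 ?sqr_ge0// ltW.
apply: measurable_funM => //; apply: measurableT_comp => //.
  exact: measurable_invr.
apply: measurable_funD => //; apply: measurable_funX.
exact: measurable_funB.
Qed.

End fundamental_theorem.

(** * The Poisson kernel *)

Section poisson_semigroup.
Context {R : realType}.
Notation mu := (@lebesgue_measure R).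
Notation ig f := (mu.-integrable setT (EFin \o f)).
Notation I f := (Rintegral mu setT f).
Implicit Types (f g F : R -> R) (a b c k l m r s t x y d : R).

(* Unnormalised: the integral of [pk s] is pi, and the extensions [pext], [vext] below
   carry this factor. [rk] combines the Poisson kernel with its conjugate. *)
Definition pk s h : R := s / (h ^+ 2 + s ^+ 2).
Definition rk (al be a s y : R) : R :=
  (al * (y - a) + be * s) / ((y - a) ^+ 2 + s ^+ 2).

Lemma sqr_add_gt0 h s : 0 < s -> 0 < h ^+ 2 + s ^+ 2.
Proof. by move=> s0; rewrite ltr_wpDl ?sqr_ge0 ?exprn_gt0. Qed.

Lemma pk_ge0 s h : 0 <= s -> 0 <= pk s h.
Proof. by move=> s0; rewrite divr_ge0 ?addr_ge0 ?sqr_ge0. Qed.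

Lemma pk_sym s x y : pk s (x - y) = pk s (y - x).
Proof. by rewrite /pk -sqrrN opprB. Qed.

Lemma measurable_pk s x : measurable_fun setT (fun y => pk s (x - y)).
Proof.
apply: measurable_funM => //; apply: measurableT_comp => //.
  exact: measurable_invr.
apply: measurable_funD => //; apply: measurable_funX.
exact: measurable_funB.
Qed.

Lemma measurable_rk al be a s : measurable_fun setT (rk al be a s).
Proof.
apply: measurable_funM.
  by apply: measurable_funD => //; apply: measurable_funM => //; exact: measurable_funB.
apply: measurableT_comp => //; first exact: measurable_invr.
apply: measurable_funD => //; apply: measurable_funX.
exact: measurable_funB.
Qed.

Lemma ig_pk s x : 0 < s -> ig (fun y => pk s (x - y)).
Proof.
move=> s0; apply: ig_ext (poisson_integral x s0).1 => y.
by rewrite pk_sym.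
Qed.

Lemma I_pk s x : 0 < s -> I (fun y => pk s (x - y)) = pi.
Proof.
move=> s0; rewrite -(poisson_integral x s0).2; apply: I_ext => y.
by rewrite pk_sym.
Qed.

Lemma lin_over_quad_le a s c1 c0 y : 0 < s -> 1 <= `|y - a| ->
  `|(c1 * (y - a) + c0) / ((y - a) ^+ 2 + s ^+ 2)| <= (`|c1| + `|c0|) / `|y - a|.
Proof.
move=> s0 y1; have q0 : 0 < `|y - a| by apply: lt_le_trans y1.
rewrite normrM normfV (gtr0_norm (sqr_add_gt0 _ s0)).
rewrite ler_pdivlMr // mulrAC ler_pdivrMr ?sqr_add_gt0 //.
have h1 : `|c1 * (y - a) + c0| <= (`|c1| + `|c0|) * `|y - a|.
  rewrite (le_trans (ler_normD _ _)) // normrM mulrDl lerD2l.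
  by rewrite ler_peMr.
rewrite (le_trans (ler_wpM2r _ h1)) // -mulrA -expr2 real_normK ?num_real //.
by rewrite ler_wpM2l ?addr_ge0 // lerDl sqr_ge0.
Qed.

(** The filter is abstract so that one proof serves both ends of the line. *)
Lemma lin_over_quad_cvg (F : set_system R) (FF : Filter F) a s c1 c0 : 0 < s ->
  (forall M, \forall y \near F, M <= `|y - a|) ->
  (c1 * (y - a) + c0) / ((y - a) ^+ 2 + s ^+ 2) @[y --> F] --> (0 : R).
Proof.
move=> s0 hF; apply/cvgrPdist_le => e e0.
apply: filterS2 (hF 1) (hF ((`|c1| + `|c0|) / e)) => y y1 ye.
rewrite sub0r normrN (le_trans (lin_over_quad_le _ _ s0 y1)) //.
have q0 : 0 < `|y - a| by apply: lt_le_trans y1.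
by rewrite ler_pdivrMr // mulrC -ler_pdivrMr.
Qed.

Lemma near_dist_pinfty a M : \forall y \near +oo, M <= `|y - a|.
Proof.
near=> y; rewrite (le_trans _ (ler_norm _)) // lerBrDr.
by near: y; apply: nbhs_pinfty_ge; exact: num_real.
Unshelve. all: by end_near. Qed.

Lemma near_dist_ninfty a M : \forall y \near -oo, M <= `|y - a|.
Proof.
near=> y; rewrite distrC (le_trans _ (ler_norm _)) // lerBrDr -lerBrDl.
by near: y; apply: nbhs_ninfty_le; exact: num_real.
Unshelve. all: by end_near. Qed.

(** Each logarithm diverges, but the quotient of the two quadratics is 1 plus a linear function over
    a quadratic, hence tends to 1. *)
Lemma log_ratio_cvg (F : set_system R) (FF : Filter F) a x s t :
  0 < s -> 0 < t -> (forall M, \forall y \near F, M <= `|y - a|) ->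
  ln ((y - x) ^+ 2 + t ^+ 2) - ln ((y - a) ^+ 2 + s ^+ 2) @[y --> F] --> (0 : R).
Proof.
move=> s0 t0 hF.
pose r y := 1 + (2 * (a - x) * (y - a) + ((a - x) ^+ 2 + t ^+ 2 - s ^+ 2)) /
                ((y - a) ^+ 2 + s ^+ 2).
have rE y : ln ((y - x) ^+ 2 + t ^+ 2) - ln ((y - a) ^+ 2 + s ^+ 2) = ln (r y).
  rewrite -ln_div ?posrE ?sqr_add_gt0 //; congr ln.
  rewrite /r; have := sqr_add_gt0 (y - a) s0 => h; field.
  by rewrite gt_eqF.
under eq_fun do rewrite rE.
rewrite -ln1; apply: continuous_cvg; first exact: continuous_ln.
rewrite -[X in _ --> X]addr0; apply: cvgD; first exact: cvg_cst.
exact: lin_over_quad_cvg.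
Qed.

Lemma cvgy_atan_affine a s : 0 < s -> atan ((y - a) / s) @[y --> +oo] --> (pi / 2 : R).
Proof.
move=> s0; have h : (y - a) / s @[y --> +oo] --> +oo.
  by apply: gt0_cvgMly; [rewrite invr_gt0|exact: cvg_addrr].
by have := cvg_comp _ _ h (@cvgy_atan R).
Qed.

Lemma cvgNy_atan_affine a s : 0 < s -> atan ((y - a) / s) @[y --> -oo] --> (- (pi / 2) : R).
Proof.
move=> s0; have h := @cvgy_atan_affine (- a) s s0.
apply/cvgNy_compNP.
rewrite (_ : _ \o _ = fun y => - atan ((y - - a) / s)); first exact: cvgN.
by apply/funext => y /=; rewrite -atanN; congr atan; rewrite -mulNr; ring.
Qed.

Lemma continuous_inv_quad a s : 0 < s -> continuous (fun y => ((y - a) ^+ 2 + s ^+ 2)^-1).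
Proof.
move=> s0 y; apply: differentiable_continuous; apply/derivable1_diffP.
have e := gt_eqF (sqr_add_gt0 (y - a) s0).
by have [] := der_inv
  (der_add (der_exp 2 (der_add (der_id y) (der_cst (- a) y))) (der_cst (s ^+ 2) y)) (negbT e).
Qed.

Lemma continuous_pk x s : 0 < s -> continuous (fun y => pk s (x - y)).
Proof.
move=> s0; rewrite (_ : (fun _ => _) = fun y => s * ((y - x) ^+ 2 + s ^+ 2)^-1); last first.
  by apply/funext => y; rewrite pk_sym.
by move=> y; apply: cvgM; [exact: cvg_cst|exact: continuous_inv_quad].
Qed.

Lemma continuous_rk al be a s : 0 < s -> continuous (rk al be a s).
Proof.
move=> s0 y; apply: cvgM; last exact: continuous_inv_quad.
apply: cvgD; last exact: cvg_cst.
by apply: cvgM; [exact: cvg_cst|apply: cvgB; [exact: cvg_id|exact: cvg_cst]].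
Qed.

Lemma rk_le al be a s y : 0 < s -> `|rk al be a s y| <= (`|al| + `|be|) / s.
Proof.
move=> s0; rewrite /rk normrM normfV (gtr0_norm (sqr_add_gt0 _ s0)).
rewrite ler_pdivrMr ?sqr_add_gt0 // mulrAC ler_pdivlMr //.
rewrite (le_trans (ler_wpM2r (ltW s0) (ler_normD _ _))) // !normrM (gtr0_norm s0) !mulrDl.
rewrite lerD //.
  rewrite -mulrA ler_wpM2l // -[leRHS]addr0.
  have := sqr_ge0 (`|y - a| - s); rewrite sqrrB -normrX (ger0_norm (sqr_ge0 _)).
  have := sqr_ge0 (y - a); have := sqr_ge0 s; nra.
by rewrite -mulrA ler_wpM2l // -expr2 lerDr sqr_ge0.
Qed.

Lemma ig_mul_rk f al be a s : 0 < s -> ig f -> ig (fun y => f y * rk al be a s y).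
Proof.
move=> s0 hf.
apply: ig_ext (igM_bounded (measurable_rk al be a s) (fun y => rk_le al be a y s0) hf) => y.
by rewrite mulrC.
Qed.

(* When (x, s) = (a, t) the partial fractions used here degenerate, whence the last
   hypothesis. *)
Lemma poisson_rk x t al be a s : 0 < s -> 0 < t -> (x != a) || (s != t) ->
  I (fun y => pk t (x - y) * rk al be a s y) = pi * rk al be a (s + t) x.
Proof.
move=> s0 t0 ne.
have De0 : ((x - a) ^+ 2 + (s - t) ^+ 2) * ((x - a) ^+ 2 + (s + t) ^+ 2) != 0.
  have st : 0 < (s + t) ^+ 2 by rewrite exprn_gt0 // addr_gt0.
  rewrite mulf_neq0 //; last by rewrite gt_eqF // ltr_wpDl ?sqr_ge0.
  case/orP: ne => [xa|st'].
    by rewrite gt_eqF // ltr_pwDl ?sqr_ge0 // exprn_even_gt0 // subr_eq0.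
  by rewrite gt_eqF // ltr_wpDl ?sqr_ge0 // exprn_even_gt0 // subr_eq0.
(* Product of the squared distances from the pole x + i t to the poles a + i s and a - i s; it
   vanishes only when poles collide. *)
pose De := ((x - a) ^+ 2 + s ^+ 2 - t ^+ 2) ^+ 2 + 4 * (x - a) ^+ 2 * t ^+ 2.
have DeE : De != 0.
  by rewrite (_ : De = ((x - a) ^+ 2 + (s - t) ^+ 2) * ((x - a) ^+ 2 + (s + t) ^+ 2)) //
     /De; ring.
(* Numerators of the partial fractions. The integrand is O(|y|^-3), so the two logarithmic
   coefficients are opposite and the logarithms cancel at infinity; the arctangents leave pi (B1 +
   B2). *)
pose A' := - t * (al * ((x - a) ^+ 2 - s ^+ 2 + t ^+ 2) + 2 * be * (x - a) * s).
pose B1' := (al * (x - a) + be * s) * ((x - a) ^+ 2 + s ^+ 2 - t ^+ 2)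
            + 2 * al * (x - a) * t ^+ 2.
pose B2' := t * (be * ((x - a) ^+ 2 - s ^+ 2 + t ^+ 2) - 2 * al * (x - a) * s).
pose A := A' / De; pose B1 := B1' / De; pose B2 := B2' / De.
pose F y := A / 2 * (ln ((y - x) ^+ 2 + t ^+ 2) - ln ((y - a) ^+ 2 + s ^+ 2))
            + (B1 * atan ((y - x) / t) + B2 * atan ((y - a) / s)).
have st0 : 0 < s + t by rewrite addr_gt0.
pose L := A / 2 * 0 + (B1 * (pi / 2) + B2 * (pi / 2)).
pose M := A / 2 * 0 + (B1 * (- (pi / 2)) + B2 * (- (pi / 2))).
have -> : pi * rk al be a (s + t) x = L - M.
  have -> : rk al be a (s + t) x = B1 + B2.
    rewrite /rk /B1 /B2 /B1' /B2' -mulrDl; have h1 := sqr_add_gt0 (x - a) st0.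
    apply/eqP; rewrite eqr_div ?(gt_eqF h1) //; apply/eqP; rewrite /De; ring.
  by rewrite /L /M mulr0 !add0r; field.
apply: (@Rintegral_FTC_line R (fun y => pk t (x - y) * rk al be a s y) F L M).
- by move=> y; apply: cvgM; [exact: continuous_pk|exact: continuous_rk].
- exact/ig_mul_rk/ig_pk.
- move=> y.
  have hx := sqr_add_gt0 (y - x) t0; have ha := sqr_add_gt0 (y - a) s0.
  have dq c : is_derive y (1 : R) (fun y => y - c) (1 + 0).
    exact: der_add (der_id y) (der_cst (- c) y).
  have dN c r : is_derive y (1 : R) (fun y => (y - c) ^+ 2 + r ^+ 2)
      (2%:R * (y - c) ^+ 1 * (1 + 0) + 0).
    exact: der_add (der_exp 2 (dq c)) (der_cst (r ^+ 2) y).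
  apply: (is_derive_eq (der_add
    (der_mul (der_cst (A / 2) y) (der_add (der_ln (dN x t) hx) (der_opp (der_ln (dN a s) ha))))
    (der_add
      (der_mul (der_cst B1 y) (der_atan (der_mul (dq x) (der_cst t^-1 y))))
      (der_mul (der_cst B2 y) (der_atan (der_mul (dq a) (der_cst s^-1 y))))))).
  have key : A' * ((y - x) * ((y - a) ^+ 2 + s ^+ 2) - (y - a) * ((y - x) ^+ 2 + t ^+ 2))
      + B1' * t * ((y - a) ^+ 2 + s ^+ 2) + B2' * s * ((y - x) ^+ 2 + t ^+ 2)
      = De * (t * (al * (y - a) + be * s)).
    by rewrite /A' /B1' /B2' /De; ring.
  have e1 : 1 + ((y - x) / t) ^+ 2 = ((y - x) ^+ 2 + t ^+ 2) / t ^+ 2 by field; rewrite gt_eqF.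
  have e2 : 1 + ((y - a) / s) ^+ 2 = ((y - a) ^+ 2 + s ^+ 2) / s ^+ 2 by field; rewrite gt_eqF.
  rewrite e1 e2 /pk /rk -(sqrrN (x - y)) opprB /A /B1 /B2.
  move: (gt_eqF hx) (gt_eqF ha) (gt_eqF s0) (gt_eqF t0) key DeE.
  move: ((y - x) ^+ 2 + t ^+ 2) ((y - a) ^+ 2 + s ^+ 2) => X Y h1 h2 h3 h4.
  clear F L M A B1 B2; move: A' B1' B2' De (al * (y - a) + be * s) => A1 B3 B4 D n key h5.
  have -> : t / X * (n / Y) = (D * (t * n)) / (D * X * Y) by field; rewrite h1 h2 h5.
  by rewrite -key; field; rewrite h1 h2 h3 h4 h5.
- by apply: cvgD; [apply: cvgM; [exact: cvg_cst|apply: log_ratio_cvg => // ?; exact: near_dist_pinfty]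
     |apply: cvgD; apply: cvgM; [exact: cvg_cst|exact: cvgy_atan_affine|exact: cvg_cst|exact: cvgy_atan_affine]].
- by apply: cvgD; [apply: cvgM; [exact: cvg_cst|apply: log_ratio_cvg => // ?; exact: near_dist_ninfty]
     |apply: cvgD; apply: cvgM; [exact: cvg_cst|exact: cvgNy_atan_affine|exact: cvg_cst|exact: cvgNy_atan_affine]].
Qed.

End poisson_semigroup.

(** * Fubini for real-valued integrals *)

Section fubini_real.
Context {R : realType} d1 d2 (T1 : measurableType d1) (T2 : measurableType d2).
Variable m1 : {sigma_finite_measure set T1 -> \bar R}.
Variable m2 : {sigma_finite_measure set T2 -> \bar R}.

(** The majorant [g] gives integrability on the product by Tonelli. Integrability of every section,
    not of almost every one, identifies real and extended inner integrals without exceptional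
    sets. *)
Lemma Rintegral_Fubini (f : T1 -> T2 -> R) (g : T1 -> R) :
  measurable_fun setT (fun z : T1 * T2 => f z.1 z.2) ->
  (forall x, m2.-integrable setT (EFin \o f x)) ->
  (forall y, m1.-integrable setT (EFin \o f ^~ y)) ->
  m1.-integrable setT (EFin \o g) ->
  (forall x, Rintegral m2 setT (fun y => `|f x y|) <= g x) ->
  m1.-integrable setT (EFin \o (fun x => Rintegral m2 setT (f x))) /\
  Rintegral m1 setT (fun x => Rintegral m2 setT (f x)) =
  Rintegral m2 setT (fun y => Rintegral m1 setT (f ^~ y)).
Proof.
move=> mf fx fy hg fg.
pose F : T1 * T2 -> \bar R := fun z => (f z.1 z.2)%:E.
have mF : measurable_fun setT F by apply/measurable_EFinP.
have e1 x : (\int[m2]_y F (x, y) = (Rintegral m2 setT (f x))%:E)%E.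
  by rewrite /Rintegral fineK //; exact: (integrable_fin_num measurableT (fx x)).
have e2 y : (\int[m1]_x F (x, y) = (Rintegral m1 setT (f ^~ y))%:E)%E.
  by rewrite /Rintegral fineK //; exact: (integrable_fin_num measurableT (fy y)).
have e3 x : (\int[m2]_y `|F (x, y)| = (Rintegral m2 setT (fun y => `|f x y|))%:E)%E.
  rewrite /Rintegral fineK //.
  exact: (integrable_fin_num measurableT (integrable_norm (fx x))).
have iF : (m1 \x m2)%E.-integrable setT F.
  apply/integrable12ltyP => //.
  have mG : measurable_fun setT (fun x => \int[m2]_y `|F (x, y)|)%E.
    apply: (measurable_fun_fubini_tonelli_F (abse \o F)) => //=.
    exact: measurableT_comp.
  apply: (@le_lt_trans _ _ (\int[m1]_x (g x)%:E)%E).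
    apply: ge0_le_integral => //.
    - by move=> x _; exact: integral_ge0.
    - exact: (measurable_int m1).
    - by move=> x _; rewrite e3 lee_fin.
  by rewrite ltey_eq (integrable_fin_num measurableT hg).
split.
- have := integrable_fubini_F iF; apply: eq_integrable => // x _.
  by rewrite /= /fubini_F e1.
- have := Fubini iF.
  rewrite (eq_integral (fun x => (Rintegral m2 setT (f x))%:E)) // => h.
  rewrite /Rintegral h; congr fine.
  by apply: eq_integral => y _; rewrite e2.
Qed.

Lemma measurable_Rintegral (f : T1 -> T2 -> R) :
  measurable_fun setT (fun z : T1 * T2 => f z.1 z.2) ->
  (forall x y, 0 <= f x y) ->
  measurable_fun setT (fun x => Rintegral m2 setT (f x)).
Proof.
move=> mf f0; apply: measurableT_comp => //.
pose F (z : T1 * T2) : \bar R := (f z.1 z.2)%:E.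
have F0 z : (0 <= F z)%E by rewrite lee_fin.
have mF : measurable_fun setT F by exact/measurable_EFinP.
by apply: (measurable_fun_fubini_tonelli_F F).
Qed.

End fubini_real.

(** * Poisson extension of a bounded measurable function *)

Section poisson_extension.
Context {R : realType}.
Notation mu := (@lebesgue_measure R).
Notation ig f := (mu.-integrable setT (EFin \o f)).
Notation I f := (Rintegral mu setT f).
Implicit Types (f g F psi phi : R -> R) (a b c k l m r s t x y d K : R).

Definition pext phi x s : R := I (fun y => phi y * pk s (x - y)).
(** At t = 1 this is the function F of the overview. The endpoint 0 is left out because [pext] does
    not carry its boundary value there. *)
Definition vext phi x t : R := Rintegral mu `]0, t] (pext phi x).

Variables (phi : R -> R) (K : R).
Hypothesis mphi : measurable_fun setT phi.
Hypothesis phiK : forall x, `|phi x| <= K.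

Local Notation u := (pext phi).
Local Notation V := (vext phi).

Lemma bound_ge0 : 0 <= K. Proof. exact: le_trans (phiK 0). Qed.

Lemma ig_phi f : ig f -> ig (fun y => phi y * f y).
Proof. exact: igM_bounded. Qed.

Lemma I_phi_le f : ig f -> (forall y, 0 <= f y) -> `|I (fun y => phi y * f y)| <= K * I f.
Proof.
move=> hf f0; rewrite -IZ //; apply: I_norm_le; [exact: ig_phi|exact: igZ|].
by move=> y; rewrite normrM (ger0_norm (f0 y)) ler_wpM2r.
Qed.

(** A default value: at height 0 the kernel formula gives 0 instead of a point mass. It lets bounds
    be stated for all s >= 0, and so for the heights [|s|] used in the measurability arguments. *)
Lemma pext0 x : u x 0 = 0.
Proof.
rewrite /pext (I_ext (g := fun=> 0)) ?Rintegral_cst ?mul0r // => y.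
by rewrite /pk mul0r mulr0.
Qed.

Lemma pext_le x s : 0 <= s -> `|u x s| <= K * pi.
Proof.
rewrite le_eqVlt => /predU1P[<-|s0].
  by rewrite pext0 normr0 mulr_ge0 ?bound_ge0 ?pi_ge0.
rewrite -(I_pk x s0); apply: I_phi_le; first exact: ig_pk.
by move=> y; rewrite pk_ge0 // ltW.
Qed.

Lemma pk_le s h : 0 < s -> pk s h <= s^-1.
Proof.
move=> s0; rewrite /pk ler_pdivrMr ?sqr_add_gt0 //.
by rewrite ler_pdivlMl // -expr2 lerDr sqr_ge0.
Qed.

Lemma measurable_pk2 : measurable_fun setT (fun z : (R * R) * R => pk `|z.1.2| (z.1.1 - z.2)).
Proof.
have m2 : measurable_fun setT (fun z : (R * R) * R => `|z.1.2|).
  by apply: measurableT_comp => //; apply: measurableT_comp => //.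
apply: measurable_funM => //; apply: measurableT_comp => //.
  exact: measurable_invr.
apply: measurable_funD; apply: measurable_funX => //.
by apply: measurable_funB => //; apply: measurableT_comp => //.
Qed.

Lemma measurable_pext2 : measurable_fun setT (fun z : R * R => u z.1 `|z.2|).
Proof.
(* Tonelli wants nonnegative integrands: c = 1 gives phi shifted by K, c = 0 the bare kernel, and u
   is recovered by subtracting K times the latter. *)
pose f (c : nat) (z : R * R) y := (phi y + K) ^+ c * pk `|z.2| (z.1 - y).
have hf (c : nat) : measurable_fun setT (fun z : R * R => I (f c z)).
  apply: (@measurable_Rintegral R _ _ _ _ mu (f c)); last first.
    move=> z y; rewrite mulr_ge0 ?pk_ge0 // exprn_ge0 // -lerBlDr sub0r.
    by have := phiK y; rewrite ler_norml => /andP[].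
  apply: measurable_funM; last exact: measurable_pk2.
  apply: measurable_funX; apply: measurable_funD => //.
  exact: measurableT_comp.
have e z : u z.1 `|z.2| = I (f 1%N z) - K * I (f 0%N z).
  have h0 : ig (fun y => pk `|z.2| (z.1 - y)).
    have [->|z0] := eqVneq z.2 0; last by apply: ig_pk; rewrite normr_gt0.
    apply: ig_ext (igZ 0 (ig_pk 0 ltr01)) => y.
    by rewrite /pk normr0 !mul0r.
  rewrite (I_ext (f := f 1%N z) (g := fun y => phi y * pk `|z.2| (z.1 - y) + K * pk `|z.2| (z.1 - y))).
    rewrite (ID (ig_phi h0) (igZ K h0)) (IZ K h0).
    rewrite (I_ext (f := f 0%N z) (g := fun y => pk `|z.2| (z.1 - y))); first by rewrite addrK.
    by move=> y; rewrite /f mul1r.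
  by move=> y; rewrite /f mulrDl.
apply: (eq_measurable_fun (fun z : R * R => I (f 1%N z) - K * I (f 0%N z))).
  by move=> z _; rewrite e.
by apply: measurable_funB => //; apply: measurable_funM.
Qed.

(** The Poisson operator is symmetric. With psi a Poisson kernel this leads to the semigroup law,
    with psi an increment of [rk] to the weak equation. *)
Lemma pext_fubini psi s : 0 < s -> ig psi ->
  ig (fun y => psi y * u y s) /\
  I (fun y => psi y * u y s) = I (fun z => phi z * I (fun y => psi y * pk s (y - z))).
Proof.
move=> s0 hpsi.
have mpsi := ig_measurable hpsi.
pose f y z := psi y * (phi z * pk s (y - z)).
have e y : I (f y) = psi y * u y s by rewrite /f IZ //; exact/ig_phi/ig_pk.
have [|||||h1 h2] := @Rintegral_Fubini R _ _ _ _ mu mu f (fun y => `|psi y| * (K * pi)).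
- apply: measurable_funM; first exact: (measurableT_comp mpsi).
  apply: measurable_funM; first exact: (measurableT_comp mphi).
  apply: measurable_funM => //; apply: measurableT_comp => //.
    exact: measurable_invr.
  apply: measurable_funD => //; apply: measurable_funX.
  exact: measurable_funB.
- by move=> y; apply/igZ/ig_phi/ig_pk.
- move=> z; apply: (@ig_le _ _ (fun y => K / s * `|psi y|)).
  + apply: measurable_funM => //; apply: measurable_funM => //.
    by under eq_fun do rewrite pk_sym; exact: measurable_pk.
  + exact/igZ/ig_norm.
  + move=> y; rewrite /f normrM mulrC ler_wpM2r // normrM ler_pM //.
    by rewrite (ger0_norm (pk_ge0 _ (ltW s0))) pk_le.
- by apply: ig_ext (igZ (K * pi) (ig_norm hpsi)) => y; rewrite mulrC.
- move=> y; rewrite (I_ext (g := fun z => `|psi y| * `|phi z * pk s (y - z)|)); last first.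
    by move=> z; rewrite normrM.
  rewrite IZ; last by apply/ig_norm/ig_phi/ig_pk.
  rewrite ler_wpM2l // -(I_pk y s0) -IZ; last exact: ig_pk.
  apply: I_le; [by apply/ig_norm/ig_phi/ig_pk|by apply/igZ/ig_pk|].
  by move=> z; rewrite normrM ler_pM // ger0_norm // pk_ge0 // ltW.
split; first by apply: ig_ext h1.
rewrite -(I_ext e) h2 {h1 h2}; apply: I_ext => z.
rewrite -IZ.
  by apply: I_ext => y; rewrite /f mulrCA.
apply: ig_ext (igM_bounded (f := fun y => pk s (y - z)) (k := s^-1) _ _ hpsi).
- by move=> y; rewrite mulrC.
- by under eq_fun do rewrite pk_sym; exact: measurable_pk.
- by move=> y; rewrite ger0_norm ?pk_le // pk_ge0 // ltW.
Qed.

Lemma vext_fubini psi t : 0 <= t -> ig psi ->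
  I (fun y => psi y * V y t) =
  Rintegral mu `]0, t] (fun s => I (fun y => psi y * u y s)).
Proof.
move=> t0 hpsi; have mpsi := ig_measurable hpsi.
pose f y s := psi y * (u y `|s| * \1_(`]0, t]) s).
have mu1 y : measurable_fun setT (fun s => u y `|s|).
  exact: (measurable_fun_pair2 y measurable_pext2).
have mu2 s : measurable_fun setT (fun y => u y `|s|).
  exact: (measurable_fun_pair1 s measurable_pext2).
have m1 : measurable_fun setT (\1_(`]0, t]) : R -> R) by exact: measurable_indic.
have i1 : ig (\1_(`]0, t]) : R -> R).
  by apply: integrable_indic_itv.
have i2 y : ig (fun s => u y `|s| * \1_(`]0, t]) s).
  apply: igM_bounded i1 => // s; exact/pext_le.
have b1 s : 0 <= (\1_(`]0, t]) : R -> R) s <= 1.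
  by rewrite indicE; case: (_ \in _); rewrite /= ?lexx ?ler01.
have eV y : V y t = I (fun s => u y `|s| * \1_(`]0, t]) s).
  rewrite /vext Rintegral_mkcond; apply: I_ext => s.
  rewrite patchE indicE; case: ifPn => [|_]; last by rewrite mulr0.
  by rewrite inE /= in_itv/= => /andP[/ltW s0 _]; rewrite mulr1 ger0_norm.
have e y : psi y * V y t = I (f y) by rewrite eV -IZ.
have [|||||_ h] := @Rintegral_Fubini R _ _ _ _ mu mu f (fun y => `|psi y| * (K * pi * I (\1_(`]0, t])))).
- apply: measurable_funM; first exact: (measurableT_comp mpsi).
  apply: measurable_funM; first exact: measurable_pext2.
  exact: (measurableT_comp m1).
- by move=> y; apply: igZ.
- move=> s; apply: (@ig_le _ _ (fun y => K * pi * `|psi y|)).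
  + by apply: measurable_funM => //; apply: measurable_funM.
  + exact/igZ/ig_norm.
  + move=> y; rewrite /f normrM mulrC ler_wpM2r // normrM -[leRHS]mulr1 ler_pM //.
      exact: pext_le.
    by have /andP[? ?] := b1 s; rewrite ger0_norm.
- by apply: ig_ext (igZ (K * pi * I (\1_(`]0, t]))) (ig_norm hpsi)) => y; rewrite mulrC.
- move=> y; rewrite (I_ext (f := fun s => `|f y s|) (g := fun s => `|psi y| * `|u y `|s| * \1_(`]0, t]) s|)); last first.
    by move=> s; rewrite /f normrM.
  rewrite IZ; last exact: ig_norm.
  rewrite ler_wpM2l // -IZ //; apply: I_le; [exact: ig_norm|exact: igZ|].
  move=> s; have /andP[? ?] := b1 s.
  by rewrite normrM (ger0_norm (_ : 0 <= \1_(`]0, t]) s)) // ler_wpM2r // pext_le.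
rewrite (I_ext e) h {h} [RHS]Rintegral_mkcond; apply: I_ext => s.
rewrite patchE /f indicE; case: ifPn => [|_].
  rewrite inE /= in_itv/= => /andP[/ltW s0 _].
  by apply: I_ext => y; rewrite mulr1 ger0_norm.
rewrite (I_ext (g := fun=> 0)) ?Rintegral_cst ?mul0r // => y.
by rewrite !mulr0.
Qed.

End poisson_extension.

(** * Regularity at positive height, semigroup law *)

Section poisson_regularity.
Context {R : realType}.
Notation mu := (@lebesgue_measure R).
Notation ig f := (mu.-integrable setT (EFin \o f)).
Notation I f := (Rintegral mu setT f).
Implicit Types (f g F psi : R -> R) (a b c k l m r s t x y d : R).

Lemma integrable_itv_bounded f a b M : measurable_fun `]a, b] f ->
  (forall s, a < s <= b -> `|f s| <= M) -> mu.-integrable `]a, b] (EFin \o f).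
Proof.
move=> mf fM.
have h : (lebesgue_measure (`]a, b]%classic : set R) < +oo)%E.
  by rewrite lebesgue_measure_itv /=; case: ifP => // _; rewrite ltry.
apply: (measurable_bounded_integrable _ h mf) => //.
exists M; split; first exact: num_real.
by move=> N MN s /=; rewrite in_itv /= => sab; exact: (le_trans (fM s sab) (ltW MN)).
Qed.

Lemma Rintegral_itv_dist f a b c M : a <= b ->
  mu.-integrable `]a, b] (EFin \o f) ->
  (forall s, a < s <= b -> `|f s - c| <= M) ->
  `|Rintegral mu `]a, b] f - c * (b - a)| <= M * (b - a).
Proof.
move=> ab hf fM.
have hk k : mu.-integrable `]a, b] (EFin \o (fun=> k)).
  by apply: (@integrable_itv_bounded _ _ _ `|k|).
have ek k : Rintegral mu `]a, b] (fun=> k) = k * (b - a).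
  have h : lebesgue_measure (`]a, b]%classic : set R) = (b - a)%:E.
    rewrite lebesgue_measure_itv /= lte_fin; case: ltP => // ba.
    have -> : a = b by apply/eqP; rewrite eq_le ab.
    by rewrite subrr.
  transitivity (k * fine (lebesgue_measure (`]a, b]%classic : set R))).
    by rewrite Rintegral_cst.
  by rewrite h.
rewrite -(ek c) -(ek M) -RintegralB //.
apply: (le_trans (le_normr_Rintegral _ _)) => //.
  exact: (integrableB _ hf (hk c)).
apply: le_Rintegral => //.
  by apply: integrable_norm; exact: (integrableB _ hf (hk c)).
Qed.

Variables (phi : R -> R) (K : R).
Hypothesis mphi : measurable_fun setT phi.
Hypothesis phiK : forall x, `|phi x| <= K.

Local Notation u := (pext phi).
Local Notation V := (vext phi).

Let K0 : 0 <= K := bound_ge0 phiK.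

(** The error is a multiple of the kernel itself, so integrating it against phi uses nothing but the
    bound K and the mass pi. The same holds for [pk_lip_space]. *)
Lemma pk_lip_time s s' h : 0 < s -> s <= s' -> `|pk s' h - pk s h| <= (s' - s) / s * pk s h.
Proof.
move=> s0 ss'; have s'0 := lt_le_trans s0 ss'.
have X0 := sqr_add_gt0 h s0; have Y0 := sqr_add_gt0 h s'0.
rewrite [X in `|X|](_ : _ = (s' - s) * ((h ^+ 2 - s * s') / ((h ^+ 2 + s ^+ 2) * (h ^+ 2 + s' ^+ 2)))); last first.
  by rewrite /pk; field; rewrite (gt_eqF X0) (gt_eqF Y0).
rewrite [leRHS](_ : _ = (s' - s) * (h ^+ 2 + s ^+ 2)^-1); last first.
  by rewrite /pk; field; rewrite (gt_eqF X0) (gt_eqF s0).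
rewrite normrM (ger0_norm (_ : 0 <= s' - s)) ?subr_ge0 // ler_wpM2l ?subr_ge0 //.
rewrite normrM normfV (gtr0_norm (mulr_gt0 X0 Y0)) ler_pdivrMr ?mulr_gt0 // mulKf ?gt_eqF //.
by have h2 := sqr_ge0 h; rewrite ler_norml; apply/andP; split; nra.
Qed.

Lemma pk_lip_space s h h' : 0 < s ->
  `|pk s h - pk s h'| <= `|h - h'| / (2 * s) * (pk s h + pk s h').
Proof.
move=> s0; have X0 := sqr_add_gt0 h s0; have Y0 := sqr_add_gt0 h' s0.
rewrite [X in `|X|](_ : _ = (h - h') * (- (s * (h + h')) / ((h ^+ 2 + s ^+ 2) * (h' ^+ 2 + s ^+ 2)))); last first.
  by rewrite /pk; field; rewrite (gt_eqF X0) (gt_eqF Y0).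
rewrite [leRHS](_ : _ = `|h - h'| * ((h ^+ 2 + s ^+ 2 + (h' ^+ 2 + s ^+ 2)) / 2 / ((h ^+ 2 + s ^+ 2) * (h' ^+ 2 + s ^+ 2)))); last first.
  by rewrite /pk; field; rewrite (gt_eqF X0) (gt_eqF Y0) (gt_eqF s0).
rewrite normrM ler_wpM2l //.
rewrite normrM normfV (gtr0_norm (mulr_gt0 X0 Y0)) ler_wpM2r ?invr_ge0 ?mulr_ge0 ?(ltW X0) ?(ltW Y0) //.
rewrite ler_norml; have := sqr_ge0 (h - s); have := sqr_ge0 (h + s); have := sqr_ge0 (h' - s); have := sqr_ge0 (h' + s).
rewrite !expr2 => *; apply/andP; split; nra.
Qed.

Lemma pext_lip_time x s s' : 0 < s -> s <= s' -> `|u x s' - u x s| <= K * pi * ((s' - s) / s).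
Proof.
move=> s0 ss'; have s'0 := lt_le_trans s0 ss'.
have h1 := ig_phi mphi phiK (ig_pk x s0); have h2 := ig_phi mphi phiK (ig_pk x s'0).
rewrite /pext -IB // -(I_pk x s0) mulrAC -IZ; last exact: ig_pk.
apply: I_norm_le; [exact: igB|by apply/igZ/ig_pk|].
move=> y; rewrite -mulrBr normrM -mulrA ler_pM // pk_lip_time //.
Qed.

Lemma pext_lip_space x x' s : 0 < s -> `|u x s - u x' s| <= K * pi * (`|x - x'| / s).
Proof.
move=> s0.
have h1 := ig_phi mphi phiK (ig_pk x s0); have h2 := ig_phi mphi phiK (ig_pk x' s0).
rewrite /pext -IB //.
have -> : K * pi * (`|x - x'| / s) = K * (`|x - x'| / (2 * s)) * (pi + pi).
  by field; rewrite gt_eqF.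
rewrite -{1}(I_pk x s0) -(I_pk x' s0) -ID; [|exact: ig_pk|exact: ig_pk].
rewrite -IZ; last by apply: igD; exact: ig_pk.
apply: I_norm_le; [exact: igB|by apply/igZ/igD; exact: ig_pk|].
move=> y; rewrite -mulrBr normrM -mulrA ler_pM //.
rewrite (le_trans (pk_lip_space _ _ s0)) //.
by rewrite (_ : x - y - (x' - y) = x - x') //; ring.
Qed.

Lemma continuous_pext_time x s : 0 < s -> {for s, continuous (u x)}.
Proof.
move=> s0; apply/cvgrPdist_le => /= e e0.
have C0 : 0 < K * pi + 1 by rewrite ltr_wpDl ?mulr_ge0 ?pi_ge0.
near=> s'.
have hs' : `|s - s'| <= e * (s / 2) / (K * pi + 1).
  near: s'; apply: cvgr_dist_le; first exact: cvg_id.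
  by rewrite divr_gt0 // mulr_gt0 // divr_gt0.
have s'2 : s / 2 <= s'.
  have : `|s - s'| <= s / 2.
    by near: s'; apply: cvgr_dist_le; [exact: cvg_id|rewrite divr_gt0].
  by rewrite ler_norml => /andP[_]; lra.
have key a b : s / 2 <= a -> a <= b -> b - a = `|s - s'| -> `|u x b - u x a| <= e.
  move=> ha hab hd; have s20 : 0 < s / 2 by rewrite divr_gt0.
  have a0 := lt_le_trans s20 ha.
  rewrite (le_trans (pext_lip_time x a0 hab)) // hd.
  apply: (@le_trans _ _ ((K * pi + 1) * (`|s - s'| / (s / 2)))).
    apply: ler_pM; rewrite ?mulr_ge0 ?pi_ge0 ?invr_ge0 ?(ltW a0) ?lerDl //.
    by rewrite ler_wpM2l // lef_pV2.
  by rewrite mulrA ler_pdivrMr // mulrC -ler_pdivlMr.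
case: (leP s s') => ss'.
  rewrite distrC; apply: key => //; first by lra.
  by rewrite distrC ger0_norm // subr_ge0.
by apply: key => //; [exact: ltW|rewrite gtr0_norm // subr_gt0].
Unshelve. all: by end_near. Qed.

Lemma continuous_pext_space s : 0 < s -> continuous (u ^~ s).
Proof.
move=> s0 x; apply/cvgrPdist_le => /= e e0.
have C0 : 0 < K * pi + 1 by rewrite ltr_wpDl ?mulr_ge0 ?pi_ge0.
near=> x'.
have hx : `|x - x'| <= e * s / (K * pi + 1).
  near: x'; apply: cvgr_dist_le; first exact: cvg_id.
  by rewrite divr_gt0 // mulr_gt0.
rewrite (le_trans (pext_lip_space x x' s0)) //.
apply: (@le_trans _ _ ((K * pi + 1) * (`|x - x'| / s))).
  by rewrite ler_wpM2r ?divr_ge0 ?lerDl // ltW.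
by rewrite mulrA ler_pdivrMr // mulrC -ler_pdivlMr.
Unshelve. all: by end_near. Qed.

Lemma measurable_pext_time x a b : 0 <= a -> measurable_fun `]a, b] (u x).
Proof.
move=> a0; apply: (eq_measurable_fun (fun s => u x `|s|)).
  move=> s; rewrite inE /= in_itv /= => /andP[s0 _].
  by rewrite gtr0_norm // (le_lt_trans a0).
apply: measurable_funTS.
exact: (measurable_fun_pair2 x (measurable_pext2 mphi phiK)).
Qed.

Lemma integrable_pext_time x t : mu.-integrable `]0, t] (EFin \o u x).
Proof.
apply: (@integrable_itv_bounded _ _ _ (K * pi)); first exact: measurable_pext_time.
by move=> s /andP[/ltW s0 _]; exact: (pext_le mphi phiK).
Qed.

Lemma vext_diff x a b : 0 <= a -> a <= b ->
  V x b - V x a = Rintegral mu `]a, b] (u x).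
Proof.
by move=> a0 ab; rewrite /vext Rintegral_itvB //; exact: integrable_pext_time.
Qed.

Lemma vext_dist x a b c M : 0 <= a -> a <= b ->
  (forall s, a < s <= b -> `|u x s - c| <= M) ->
  `|V x b - V x a - c * (b - a)| <= M * (b - a).
Proof.
move=> a0 ab h; rewrite vext_diff //; apply: Rintegral_itv_dist => //.
apply: integrableS (integrable_pext_time x b) => //.
by apply: subset_itvr; rewrite bnd_simp.
Qed.

Lemma vext0 x : V x 0 = 0.
Proof. by rewrite /vext set_itvoc0 Rintegral_set0. Qed.

Lemma vext_shift x r t : 0 <= r -> 0 < t ->
  Rintegral mu `]0, r] (fun s => u x (s + t)) = V x (r + t) - V x t.
Proof.
move=> r0 t0; have tr : t <= r + t by rewrite lerDr.
rewrite (vext_diff x (ltW t0) tr).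
pose S s := s + t.
have dS : derive1 S = cst 1.
  apply/funext => s; rewrite derive1E.
  have h := der_add (der_id s) (der_cst t s).
  by rewrite (@derive_val _ _ _ _ _ _ _ h) addr0.
have cu s : t <= s -> {for s, continuous (u x)}.
  by move=> ts; apply: continuous_pext_time; exact: lt_le_trans ts.
have e : (\int[mu]_(s in `[S 0%R, S r]) (u x s)%:E =
    \int[mu]_(s in `[0%R, r]) (((u x \o S) * derive1 S) s)%:E)%E.
  apply: integration_by_substitution_increasing => //.
  - by move=> a b _ _ ab; rewrite /S ltrD2r.
  - by rewrite dS => s _; exact: cst_continuous.
  - by rewrite dS; exact: is_cvg_cst.
  - by rewrite dS; exact: is_cvg_cst.
  - have cS : continuous S by move=> s; apply: cvgD; [exact: cvg_id|exact: cvg_cst].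
    split; last 2 first.
      exact/cvg_at_right_filter/cS.
      exact/cvg_at_left_filter/cS.
    by move=> s _; have [] := der_add (der_id s) (der_cst t s).
  - apply/continuous_in_subspaceT => s; rewrite inE /= in_itv /= /S add0r => /andP[ts _].
    exact: cu.
have mus a b : 0 <= a -> measurable_fun `]a, b] (EFin \o u x).
  by move=> a0; have /measurable_EFinP := @measurable_pext_time x a b a0; exact.
rewrite /Rintegral [in RHS]integral_itv_obnd_cbnd; last exact: (mus _ _ (ltW t0)).
rewrite integral_itv_obnd_cbnd; last first.
  apply/measurable_EFinP; apply: (eq_measurable_fun (fun s => u x `|s + t|)).
    move=> s; rewrite inE /= in_itv /= => /andP[s0 _].
    by rewrite gtr0_norm // addr_gt0.
  apply: measurable_funTS.
  apply: (measurableT_comp (measurable_fun_pair2 x (measurable_pext2 mphi phiK))).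
  exact: measurable_funD.
rewrite /S add0r in e; rewrite e; congr fine; apply: eq_integral => s _.
by rewrite dS /= !fctE mulr1.
Qed.

(** Each u(., s) with s > 0 is continuous and K pi dominates on []0, t]], so no continuity of phi
    enters. The maximum principle relies on this to have maxima attained. *)
Lemma continuous_vext t : continuous (V ^~ t).
Proof.
move=> x; apply: (@continuity_under_integral R _ _ mu (fun x s => u x s) `]0, t] _ (x - 1) (x + 1) _ _ (fun=> K * pi)).
- by [].
- by move=> y _; exact: integrable_pext_time.
- apply: aeW => s /=; rewrite in_itv /= => /andP[s0 _] y _.
  exact: continuous_pext_space.
- by apply: (@integrable_itv_bounded _ _ _ `|K * pi|).
- move=> y _; apply: aeW => s /=; rewrite in_itv /= => /andP[/ltW s0 _].
  exact: (pext_le mphi phiK).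
- by rewrite inE /= in_itv /=; lra.
Qed.

Lemma pext_semigroup_neq x s t : 0 < s -> 0 < t -> s != t ->
  I (fun y => pk t (x - y) * u y s) = pi * u x (s + t).
Proof.
move=> s0 t0 st; have st0 : 0 < s + t by rewrite addr_gt0.
have [_ ->] := pext_fubini mphi phiK s0 (ig_pk x t0).
rewrite /pext -IZ; last exact/(ig_phi mphi phiK)/ig_pk.
have e r y z : pk r (y - z) = rk 0 1 z r y by rewrite /pk /rk mul0r add0r mul1r.
apply: I_ext => z; rewrite mulrCA; congr (_ * _).
rewrite e -poisson_rk ?st ?orbT //.
by apply: I_ext => y; rewrite -e.
Qed.

(* The case s = t, missing from [poisson_rk], follows by continuity. *)
Lemma pext_semigroup x s t : 0 < s -> 0 < t ->
  I (fun y => pk t (x - y) * u y s) = pi * u x (s + t).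
Proof.
move=> s0 t0; have [<-{t t0}|] := eqVneq s t; last exact: pext_semigroup_neq.
have hi r : 0 < r -> ig (fun y => pk s (x - y) * u y r).
  by move=> r0; have [] := pext_fubini mphi phiK r0 (ig_pk x s0).
have C0 : 0 <= pi * (K * pi) :> R by rewrite !mulr_ge0 ?pi_ge0.
apply/eqP; rewrite -subr_eq0 -normr_le0; apply/ler_addgt0Pl => e e0; rewrite addr0.
(* Moving one height from s to s + d costs pi (K pi) d / s on each side of the identity; the added 1
   keeps the denominator positive when K = 0. *)
pose d := e * s / (2 * (pi * (K * pi)) + 1).
have D0 : 0 < 2 * (pi * (K * pi)) + 1 :> R by rewrite ltr_wpDl // mulr_ge0.
have d0 : 0 < d by rewrite /d divr_gt0 // mulr_gt0.
have r0 : 0 < s + d by rewrite addr_gt0.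
have h1 : `|I (fun y => pk s (x - y) * u y (s + d)) - I (fun y => pk s (x - y) * u y s)|
    <= pi * (K * pi) * (d / s).
  rewrite -IB; [|exact: hi|exact: hi].
  have -> : pi * (K * pi) * (d / s) = (K * pi * (d / s)) * pi by ring.
  rewrite -[X in _ * X](I_pk x s0) -IZ; last exact: ig_pk.
  apply: I_norm_le; [by apply: igB; exact: hi|by apply/igZ/ig_pk|].
  move=> y; rewrite -mulrBr normrM ger0_norm ?pk_ge0 ?(ltW s0) // mulrC.
  rewrite ler_wpM2r ?pk_ge0 ?(ltW s0) //.
  have := pext_lip_time y s0 (_ : s <= s + d).
  by rewrite (_ : s + d - s = d); [apply; rewrite lerDl ltW|ring].
have h2 : `|pi * u x (s + d + s) - pi * u x (s + s)| <= pi * (K * pi) * (d / s).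
  rewrite -mulrBr normrM ger0_norm ?pi_ge0 // -mulrA ler_wpM2l ?pi_ge0 //.
  have ss0 : 0 < s + s by rewrite addr_gt0.
  have := pext_lip_time x ss0 (_ : s + s <= s + d + s).
  rewrite (_ : s + d + s - (s + s) = d); last by ring.
  move=> h; rewrite (le_trans (h _)) //; first by rewrite addrAC lerDl ltW.
  rewrite ler_wpM2l ?mulr_ge0 ?pi_ge0 // ler_wpM2l ?(ltW d0) //.
  by rewrite lef_pV2 ?posrE // lerDl ltW.
have sd : s + d != s by rewrite -subr_eq0 addrC addKr gt_eqF.
move: h1; rewrite (pext_semigroup_neq x r0 s0 sd) => h1.
have -> : e = pi * (K * pi) * (d / s) * 2 + d / s.
  have eD : e * s = d * (2 * (pi * (K * pi)) + 1) by rewrite /d divfK ?gt_eqF.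
  by apply: (mulIf (lt0r_neq0 s0)); rewrite eD; field; exact: lt0r_neq0.
have q0 : 0 <= d / s by rewrite divr_ge0 // ltW.
move: h1 h2; rewrite !ler_norml => /andP[? ?] /andP[? ?]; apply/andP; split; lra.
Qed.

(** Under the height integral the semigroup law shifts the interval from []0, r]] to []t, r +
    t]]. *)
Lemma poisson_vext x r t : 0 <= r -> 0 < t ->
  I (fun y => pk t (x - y) * V y r) = pi * (V x (r + t) - V x t).
Proof.
move=> r0 t0; rewrite (vext_fubini mphi phiK r0 (ig_pk x t0)) -(vext_shift x r0 t0).
rewrite -RintegralZl //.
  apply: eq_Rintegral => s; rewrite inE /= in_itv /= => /andP[s0 _].
  exact: pext_semigroup.
apply: (@integrable_itv_bounded _ _ _ (K * pi)).
  apply: (eq_measurable_fun (fun s => u x `|s + t|)).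
    move=> s; rewrite inE /= in_itv /= => /andP[s0 _].
    by rewrite gtr0_norm // addr_gt0.
  apply: measurable_funTS.
  apply: (measurableT_comp (measurable_fun_pair2 x (measurable_pext2 mphi phiK))).
  exact: measurable_funD.
by move=> s /andP[s0 _]; apply: (pext_le mphi phiK); rewrite addr_ge0 // ltW.
Qed.

End poisson_regularity.

(** * A one-sided maximum principle *)

Section convexity.
Context {R : realType}.
Implicit Types (H : R -> R) (a b x y : R).

(** The supremum of the chord slopes to the left of x is a supporting slope, since every chord slope
    to the right bounds it. *)
Lemma convex_support H x :
  (forall a y b, a < y -> y < b ->
     (b - a) * H y <= (b - y) * H a + (y - a) * H b) ->
  exists be, forall y, H x + be * (y - x) <= H y.
Proof.
move=> cvx; pose S : set R := [set r | exists2 a, a < x & r = (H x - H a) / (x - a)].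
have slope a b : a < x -> x < b -> (H x - H a) / (x - a) <= (H b - H x) / (b - x).
  move=> ax xb; rewrite ler_pdivrMr ?subr_gt0 // mulrAC ler_pdivlMr ?subr_gt0 //.
  by have := cvx a x b ax xb; nra.
have S0 : S !=set0 by exists ((H x - H (x - 1)) / (x - (x - 1))), (x - 1) => //; lra.
have ubS b : x < b -> ubound S ((H b - H x) / (b - x)).
  by move=> xb _ [a ax ->]; exact: slope.
have hS : has_sup S.
  by split => //; exists ((H (x + 1) - H x) / (x + 1 - x)); apply: ubS; lra.
exists (sup S) => y; case: (ltgtP y x) => [yx|xy|->]; last by rewrite subrr mulr0 addr0.
- have : (H x - H y) / (x - y) <= sup S by apply: (ub_le_sup hS.2); exists y.
  by rewrite ler_pdivrMr ?subr_gt0 //; lra.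
- have : sup S <= (H y - H x) / (y - x) by apply: ge_sup => //; exact: ubS.
  by rewrite ler_pdivlMr ?subr_gt0 //; lra.
Qed.

End convexity.

Section maximum_principle.
Context {R : realType}.
Notation mu := (@lebesgue_measure R).
Notation ig f := (mu.-integrable setT (EFin \o f)).
Notation I f := (Rintegral mu setT f).
Implicit Types (f g F : R -> R) (a b c k l m r s t x y d : R).

(* Its kernel [pk t / t] decreases in t, so the difference of two quotients, taken
   with the kernel [pkd], is monotone in F. *)
Definition poisson_quot F x t : R := I (fun y => (F y - F x) * pk t (x - y)) / t.

Definition pkd x s t y : R := pk s (x - y) / s - pk t (x - y) / t.

(** A single kernel decays like h^-2 and has no second moment; the difference decays like h^-4 and
    can be tested against parabolas. The linear part contributes 0, the quadratic part pi (t -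
    s). *)
Lemma I_mul_pk_diff x s t : 0 < s -> s < t ->
  [/\ ig (fun y => (y - x) * pkd x s t y), I (fun y => (y - x) * pkd x s t y) = 0,
      ig (fun y => (y - x) ^+ 2 * pkd x s t y) &
      I (fun y => (y - x) ^+ 2 * pkd x s t y) = pi * (t - s)].
Proof.
move=> s0 st; set D := pkd x s t; have t0 := lt_trans s0 st.
have hX r y : 0 < r -> (x - y) ^+ 2 + r ^+ 2 != 0 by move=> r0; rewrite gt_eqF ?sqr_add_gt0.
have hX' r y : 0 < r -> (y - x) ^+ 2 + r ^+ 2 != 0 by move=> r0; rewrite gt_eqF ?sqr_add_gt0.
(* The first moment becomes the Poisson integral of a conjugate kernel centred at x, evaluated at x,
   where that kernel vanishes. *)
have e1 y : (y - x) * D y = (t ^+ 2 - s ^+ 2) / t * (pk t (x - y) * rk 1 0 x s y).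
  rewrite /D /pkd /pk /rk -(sqrrN (x - y)) opprB; field.
  by rewrite (gt_eqF s0) (gt_eqF t0) !hX'.
have e2 y : (y - x) ^+ 2 * D y = t * pk t (x - y) - s * pk s (x - y).
  rewrite /D /pkd /pk -(sqrrN (x - y)) opprB; field.
  by rewrite (gt_eqF s0) (gt_eqF t0) !hX'.
have h1 := @ig_mul_rk R (fun y => pk t (x - y)) 1 0 x s s0 (ig_pk x t0).
split.
- by apply: ig_ext (igZ ((t ^+ 2 - s ^+ 2) / t) h1) => y; rewrite e1.
- rewrite (I_ext e1) IZ // poisson_rk ?(lt_eqF st) ?orbT //.
  by rewrite /rk subrr mulr0 mul0r addr0 mul0r !mulr0.
- apply: ig_ext (igB (igZ t (ig_pk x t0)) (igZ s (ig_pk x s0))) => y.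
  by rewrite e2.
- rewrite (I_ext e2) IB; [|exact/igZ/ig_pk|exact/igZ/ig_pk].
  by rewrite (IZ t (ig_pk x t0)) (IZ s (ig_pk x s0)) !I_pk //; ring.
Qed.

Lemma pk_diff_ge0 s t h : 0 < s -> s < t -> 0 <= pk s h / s - pk t h / t.
Proof.
move=> s0 st; have t0 := lt_trans s0 st.
rewrite /pk mulrAC divff ?gt_eqF // [t / _]mulrC mulfK ?gt_eqF // mul1r subr_ge0.
rewrite lef_pV2 ?posrE ?sqr_add_gt0 // lerD2l ler_pXn2r ?nnegrE ?ltW //.
Qed.

(** Away from the centre the weighted kernel is O(t^2) with an integrable profile free of s and t,
    negligible against the second moment, which is of order t when s = t / 2. The factor 2 comes
    from h^2 + d^2 <= 2 h^2. *)
Lemma pk_diff_le s t h d : 0 < s -> s < t -> 0 < d -> d <= `|h| ->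
  h ^+ 2 * (pk s h / s - pk t h / t) <= 2 * t ^+ 2 / (h ^+ 2 + d ^+ 2).
Proof.
move=> s0 st d0 dh; have t0 := lt_trans s0 st.
have hd : d ^+ 2 <= h ^+ 2.
  by rewrite -(real_normK (num_real h)) ler_pXn2r ?nnegrE // ltW.
have X0 := sqr_add_gt0 h s0; have Y0 := sqr_add_gt0 h t0; have Z0 := sqr_add_gt0 h d0.
have -> : h ^+ 2 * (pk s h / s - pk t h / t) =
   h ^+ 2 * (t ^+ 2 - s ^+ 2) / ((h ^+ 2 + s ^+ 2) * (h ^+ 2 + t ^+ 2)).
  by rewrite /pk; field; rewrite (gt_eqF s0) (gt_eqF t0) (gt_eqF X0) (gt_eqF Y0).
rewrite ler_pdivrMr ?mulr_gt0 // [leRHS]mulrAC ler_pdivlMr //.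
have t2 := sqr_ge0 t; have s2 := sqr_ge0 s; have h2 := sqr_ge0 h; have d2 := sqr_ge0 d.
have ts : 0 <= t ^+ 2 - s ^+ 2 by rewrite subr_ge0 ler_pXn2r ?nnegrE ?ltW.
have h1 : h ^+ 2 * (t ^+ 2 - s ^+ 2) * (h ^+ 2 + d ^+ 2) <= h ^+ 2 * t ^+ 2 * (2 * h ^+ 2).
  apply: ler_pM; [exact: mulr_ge0|exact: addr_ge0| |lra].
  by rewrite ler_wpM2l // lerBlDr lerDl.
apply: (le_trans h1).
have -> : h ^+ 2 * t ^+ 2 * (2 * h ^+ 2) = 2 * t ^+ 2 * (h ^+ 2 * h ^+ 2) by ring.
apply: ler_wpM2l; first exact: mulr_ge0.
by apply: ler_pM; rewrite ?lerDl.
Qed.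

Variables (F : R -> R) (M : R).
Hypothesis cF : continuous F.
Hypothesis FM : forall x, `|F x| <= M.

Let mF : measurable_fun setT F.
Proof. exact: continuous_measurable_fun. Qed.

Let ig_Fpk x t : 0 < t -> ig (fun y => (F y - F x) * pk t (x - y)).
Proof.
move=> t0; apply: (igM_bounded (k := 2 * M)) (ig_pk x t0).
  exact: measurable_funB.
move=> y; rewrite (le_trans (ler_normB _ _)) //.
by have := FM y; have := FM x; lra.
Qed.

Lemma poisson_quot_diff x s t : 0 < s -> 0 < t ->
  ig (fun y => (F y - F x) * pkd x s t y) /\
  poisson_quot F x s - poisson_quot F x t = I (fun y => (F y - F x) * pkd x s t y).
Proof.
move=> s0 t0; set D := pkd x s t.
have e y : (F y - F x) * D y =
    s^-1 * ((F y - F x) * pk s (x - y)) - t^-1 * ((F y - F x) * pk t (x - y)).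
  by rewrite /D /pkd mulrBr mulrCA mulrC [X in _ - X]mulrCA [X in _ - X]mulrC; ring.
split.
  by apply: ig_ext (igB (igZ s^-1 (ig_Fpk x s0)) (igZ t^-1 (ig_Fpk x t0))) => y; rewrite e.
rewrite (I_ext e) IB; [|exact/igZ/ig_Fpk|exact/igZ/ig_Fpk].
by rewrite !IZ; [rewrite /poisson_quot; ring|exact: ig_Fpk|exact: ig_Fpk].
Qed.

(** Compare the quotients at t / 2 and t: by the parabola their difference is at most - la pi t / 2
    + O(t^2), while the assumed rates allow no less than - B (t / 2 + t). Letting t tend to 0 gives
    the factor 3. Only the rate at the single point x enters, so e may depend on x. *)
Lemma touching_parabola x q B e d be la : 0 <= B -> 0 < e -> 0 < d ->
  (forall t, 0 < t -> t < e -> `|poisson_quot F x t - q| <= B * t) ->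
  (forall y, `|y - x| < d -> F y <= F x + be * (y - x) - la * (y - x) ^+ 2) ->
  la * pi <= 3 * B.
Proof.
move=> B0 e0 d0 hq hF; rewrite leNgt; apply/negP => hla.
have pi0 : 0 < pi :> R by exact: pi_gt0.
have la0 : 0 < la.
  by rewrite -(pmulr_lgt0 _ pi0); apply: le_lt_trans hla; rewrite mulr_ge0.
have M0 : 0 <= M := le_trans (normr_ge0 _) (FM 0).
(* For |y - x| >= d, N (y - x)^2 dominates F y - F x - be (y - x) + la (y - x)^2, one summand for
   each part. *)
pose N := 2 * M / d ^+ 2 + `|be| / d + la.
have N0 : 0 < N.
  by rewrite /N ltr_wpDl // addr_ge0 // divr_ge0 ?mulr_ge0 ?sqr_ge0 // ltW.
have key t : 0 < t -> t < e -> la * pi <= 3 * B + 4 * N * pi / d * t.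
  move=> t0 te; have s0 : 0 < t / 2 by rewrite divr_gt0.
  have st : t / 2 < t by lra.
  have [h1 h2 h3 h4] := I_mul_pk_diff x s0 st.
  have [h5 h6] := poisson_quot_diff x s0 t0.
  set D := pkd x (t / 2) t in h1 h2 h3 h4 h5 h6.
  have D0 y : 0 <= D y by exact: (pk_diff_ge0 _ s0 st).
  pose W y := 2 * N * t ^+ 2 / d * pk d (x - y).
  have hW : ig W by exact/igZ/ig_pk.
  have le y : (F y - F x) * D y <= (be * ((y - x) * D y) - la * ((y - x) ^+ 2 * D y)) + W y.
    have W0 : 0 <= W y.
      apply: mulr_ge0; last exact/pk_ge0/ltW.
      by apply: divr_ge0 (ltW d0); apply: mulr_ge0 (sqr_ge0 t); apply: mulr_ge0 (ltW N0).
    have [yd|yd] := ltP `|y - x| d.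
      rewrite -[leLHS]addr0 lerD // (le_trans (ler_wpM2r (D0 y) (_ : _ <= be * (y - x) - la * (y - x) ^+ 2))) //.
        by have := hF y yd; lra.
      by rewrite le_eqVlt; apply/orP; left; apply/eqP; ring.
    rewrite -lerBlDl [leLHS](_ : _ =
      (F y - F x - be * (y - x) + la * (y - x) ^+ 2) * D y); last by ring.
    have dh : d <= `|x - y| by rewrite distrC.
    have := pk_diff_le s0 st d0 dh; rewrite -[_ / _ - _]/(D y) => h7.
    have h8 : F y - F x - be * (y - x) + la * (y - x) ^+ 2 <= N * (x - y) ^+ 2.
      have -> : (x - y) ^+ 2 = `|y - x| ^+ 2 by rewrite real_normK ?num_real // -sqrrN opprB.
      have -> : (y - x) ^+ 2 = `|y - x| ^+ 2 by rewrite real_normK ?num_real.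
      have g1 : F y - F x <= 2 * M.
        by have := FM y; have := FM x; rewrite !ler_norml => /andP[? ?] /andP[? ?]; lra.
      have g2 : 2 * M <= 2 * M / d ^+ 2 * `|y - x| ^+ 2.
        rewrite mulrAC ler_pdivlMr ?exprn_gt0 // ler_wpM2l ?mulr_ge0 //.
        by rewrite ler_pXn2r ?nnegrE // ltW.
      have g3 : - be * (y - x) <= `|be| / d * `|y - x| ^+ 2.
        rewrite (le_trans (ler_norm _)) // normrM normrN -mulrA ler_wpM2l //.
        by rewrite mulrC ler_pdivlMr // expr2 ler_wpM2l.
      by rewrite /N; lra.
    apply: (le_trans (ler_wpM2r (D0 y) h8)); rewrite -mulrA.
    apply: (le_trans (ler_wpM2l (ltW N0) h7)).
    rewrite le_eqVlt; apply/orP; left; apply/eqP; rewrite /W /pk.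
    by field; rewrite (gt_eqF d0) gt_eqF // sqr_add_gt0.
  have hle : poisson_quot F x (t / 2) - poisson_quot F x t <= - la * (pi * (t - t / 2)) + 2 * N * t ^+ 2 / d * pi.
    rewrite h6; apply: (le_trans (I_le h5 (igD (igB (igZ be h1) (igZ la h3)) hW) le)).
    rewrite (ID (igB (igZ be h1) (igZ la h3)) hW) (IB (igZ be h1) (igZ la h3)).
    by rewrite (IZ be h1) (IZ la h3) (IZ _ (ig_pk x d0)) h2 h4 I_pk //; lra.
  have := hq _ t0 te; have := hq _ s0 (lt_trans st te).
  rewrite !ler_norml => /andP[g1 g2] /andP[g3 g4].
  have : la * pi * t <= (3 * B + 4 * N * pi / d * t) * t.
    have -> : (3 * B + 4 * N * pi / d * t) * t = 3 * B * t + 2 * (2 * N * t ^+ 2 / d * pi).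
      by field; rewrite gt_eqF.
    lra.
  by rewrite ler_pM2r.
pose C := 4 * N * pi / d.
have C0 : 0 < C by rewrite /C divr_gt0 // !mulr_gt0.
pose t := Num.min (e / 2) ((la * pi - 3 * B) / (2 * C)).
have t0 : 0 < t.
  rewrite /t lt_min; apply/andP; split; apply: divr_gt0 => //.
    by rewrite subr_gt0.
  exact: mulr_gt0.
have te : t < e by rewrite /t gt_min; apply/orP; left; lra.
have := key t t0 te; rewrite -/C.
have : C * t <= (la * pi - 3 * B) / 2.
  rewrite mulrC -ler_pdivlMr // -mulrA -invfM /t ge_min.
  by rewrite lexx orbT.
by lra.
Qed.

(** Convexity is global, so the support line at x gives a parabola below F on the whole line.
    Testing it with [pkd x s t] makes the quotient grow by at most La pi (t - s), with no far-field
    error; s -> 0 then needs just the rate at x. *)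
Lemma poisson_quot_upper (q : R -> R) B : 0 <= B ->
  (forall x, exists2 e, 0 < e & forall t, 0 < t -> t < e -> `|poisson_quot F x t - q x| <= B * t) ->
  forall x t, 0 < t -> poisson_quot F x t - q x <= (3 * B + 1) * pi * t.
Proof.
(* Chosen so that La pi > 3 B, the value excluded by [touching_parabola]. *)
move=> B0 hq x t t0; pose La := 3 * B + 1.
have La0 : 0 <= La by rewrite addr_ge0 // mulr_ge0.
have hLa : 3 * B < La * pi.
  have := pi_ge2 R => h; rewrite /La; nra.
pose H y := F y + La * y ^+ 2.
have [be hbe] : exists be, forall y, H x + be * (y - x) <= H y.
  apply: convex_support => a z b az zb; rewrite leNgt; apply/negP => hz.
  have ab := lt_trans az zb; have ab0 : 0 < b - a by rewrite subr_gt0.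
  pose sl := (H b - H a) / (b - a).
  pose G y := H y - (H a + sl * (y - a)).
  have Gz : 0 < G z.
    have eG : (b - a) * (sl * (z - a)) = (H b - H a) * (z - a).
      by rewrite mulrA /sl [(b - a) * _]mulrC divfK // gt_eqF.
    by rewrite /G subr_gt0 -(ltr_pM2l ab0) mulrDr eG; move: hz; lra.
  have Ga : G a = 0 by rewrite /G subrr mulr0 addr0 subrr.
  have Gb : G b = 0.
    by rewrite /G /sl divfK ?gt_eqF //; ring.
  have cG : {within `[a, b], continuous G}.
    apply: continuous_subspaceT => y.
    apply: cvgB; [apply: cvgD; [exact: cF|]|apply: cvgD; [exact: cvg_cst|]].
      apply: cvgM; first exact: cvg_cst.
      exact: exprn_continuous.
    apply: cvgM; first exact: cvg_cst.
    by apply: cvgB; [exact: cvg_id|exact: cvg_cst].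
  have [c] := EVT_max (ltW ab) cG; rewrite in_itv /= => /andP[ac cb] hc.
  have Gc : 0 < G c by apply: (lt_le_trans Gz); apply: hc; rewrite in_itv /= !ltW.
  have {}ac : a < c by rewrite lt_neqAle ac andbT; apply/eqP => ac'; move: Gc; rewrite -ac' Ga ltxx.
  have {}cb : c < b by rewrite lt_neqAle cb andbT; apply/eqP => ac'; move: Gc; rewrite ac' Gb ltxx.
  have [e e0 he] := hq c.
  have d0 : 0 < Num.min (c - a) (b - c) by rewrite lt_min !subr_gt0 ac.
  (* At an interior maximum c of the gap above the chord, F lies below chord minus La y^2 up to a
     constant; expanding that parabola at c gives the slope sl - 2 La c. *)
  have := @touching_parabola c (q c) B e _ (sl - 2 * La * c) La B0 e0 d0 he.
  rewrite leNgt hLa /= => h; suff : false by []. apply: h => y.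
  rewrite lt_min !ltr_norml => /andP[/andP[y1 y2] /andP[y3 y4]].
  have : G y <= G c by apply: hc; rewrite in_itv /=; apply/andP; split; lra.
  rewrite /G /H; nra.
have lim s : 0 < s -> s < t -> poisson_quot F x t - poisson_quot F x s <= La * pi * (t - s).
  move=> s0 st.
  have [h1 h2 h3 h4] := I_mul_pk_diff x s0 st.
  have [h5 h6] := poisson_quot_diff x s0 t0.
  set D := pkd x s t in h1 h2 h3 h4 h5 h6.
  have D0 y : 0 <= D y by exact: (pk_diff_ge0 _ s0 st).
  have le y : (be - 2 * La * x) * ((y - x) * D y) - La * ((y - x) ^+ 2 * D y) <= (F y - F x) * D y.
    rewrite !mulrA -mulrBl ler_wpM2r //.
    by have := hbe y; rewrite /H; nra.
  have := I_le (igB (igZ _ h1) (igZ _ h3)) h5 le.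
  rewrite -h6 (IB (igZ _ h1) (igZ _ h3)) !IZ // h2 h4; lra.
have [e e0 he] := hq x.
apply/ler_addgt0Pr => eps eps0.
pose s := Num.min (Num.min (e / 2) (t / 2)) (eps / (B + 1)).
have s0 : 0 < s by rewrite /s !lt_min !divr_gt0 // ltr_wpDl.
have se : s < e by rewrite /s !gt_min; apply/orP; left; apply/orP; left; lra.
have st : s < t by rewrite /s !gt_min; apply/orP; left; apply/orP; right; lra.
have sB : B * s <= eps.
  have : s <= eps / (B + 1) by rewrite /s ge_min lexx orbT.
  rewrite ler_pdivlMr ?ltr_wpDl //; lra.
have := he s s0 se; rewrite ler_norml => /andP[g1 g2].
have := lim s s0 st; have pi0 : 0 < pi :> R by exact: pi_gt0.
have : 0 <= La * pi * s by apply: mulr_ge0 (ltW s0); apply: mulr_ge0 (ltW pi0).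
rewrite /La; lra.
Qed.

End maximum_principle.

Section maximum_principle_two_sided.
Context {R : realType}.
Notation mu := (@lebesgue_measure R).

Lemma poisson_quot_bound (F q : R -> R) (M B : R) : continuous F ->
  (forall x, `|F x| <= M) -> 0 <= B ->
  (forall x, exists2 e, 0 < e & forall t, 0 < t -> t < e -> `|poisson_quot F x t - q x| <= B * t) ->
  forall x t, 0 < t -> `|poisson_quot F x t - q x| <= (3 * B + 1) * pi * t.
Proof.
move=> cF FM B0 hq x t t0; rewrite ler_norml; apply/andP; split; last first.
  exact: (poisson_quot_upper cF FM).
have e y s : 0 < s -> poisson_quot (\- F) y s = - poisson_quot F y s.
  move=> s0; rewrite /poisson_quot -mulNr; congr (_ / _).
  rewrite -mulN1r -IZ.
    by apply: I_ext => z /=; ring.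
  apply: (igM_bounded (k := 2 * M)) (ig_pk y s0).
    by apply: measurable_funB => //; exact: continuous_measurable_fun.
  move=> z; rewrite (le_trans (ler_normB _ _)) //.
  by have := FM y; have := FM z; lra.
rewrite lerNl opprB addrC -[q x]opprK -e // .
apply: (@poisson_quot_upper _ (\- F) M _ _ (\- q)) => //.
- by move=> y; apply: cvgN; exact: cF.
- by move=> y; rewrite normrN.
- move=> y; have [r r0 hr] := hq y; exists r => // s s0 sr.
  by rewrite e // opprK addrC distrC; exact: hr.
Qed.

End maximum_principle_two_sided.

(** * Normal derivatives of Poisson extensions *)

Section abel_summation.
Context {R : realType}.
Notation mu := (@lebesgue_measure R).
Notation ig f := (mu.-integrable setT (EFin \o f)).
Notation I f := (Rintegral mu setT f).
Implicit Types (f g F psi : R -> R) (a b c k l m r s t x y d e : R).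

(* The e-derivative of e^2 / (e^2 + t^2): averaging the truncated kernel
   1_{e < |h|} / h^2 with this weight gives exactly 1 / (h^2 + t^2). *)
Definition abel_weight t e : R := 2 * e * t ^+ 2 / (e ^+ 2 + t ^+ 2) ^+ 2.
Local Notation w := abel_weight.

Lemma measurable_abel_weight t : measurable_fun setT (w t).
Proof.
apply: measurable_funM.
  by apply: measurable_funM => //; exact: measurable_funM.
apply: measurableT_comp; first exact: measurable_invr.
by apply: measurable_funX; apply: measurable_funD => //; exact: measurable_funX.
Qed.

Lemma abel_weight_ge0 t e : 0 <= e -> 0 <= w t e.
Proof.
move=> e0; apply: divr_ge0 (sqr_ge0 _); apply: mulr_ge0 (sqr_ge0 t).
exact: mulr_ge0.
Qed.

Lemma pk0 t e : pk t (0 - e) = pk t e.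
Proof. by rewrite /pk sub0r sqrrN. Qed.

Lemma abel_weight_le t e : 0 < t -> 0 <= e -> w t e <= pk t (0 - e).
Proof.
move=> t0 e0; rewrite pk0 /w /pk; have X0 := sqr_add_gt0 e t0.
rewrite ler_pdivrMr ?exprn_gt0 //.
have -> : t / (e ^+ 2 + t ^+ 2) * (e ^+ 2 + t ^+ 2) ^+ 2 = t * (e ^+ 2 + t ^+ 2).
  by field; rewrite gt_eqF.
rewrite (_ : 2 * e * t ^+ 2 = t * (2 * e * t)); last by ring.
by rewrite ler_pM2l // -subr_ge0 (_ : _ - _ = (e - t) ^+ 2) ?sqr_ge0 //; ring.
Qed.

(** The weight vanishes to first order at e = 0, which absorbs the 1 / e growth allowed to the
    truncated integrals. *)
Lemma abel_weight_div_le t e : 0 < t -> 0 < e -> w t e / e <= 2 / t * pk t (0 - e).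
Proof.
move=> t0 e0; rewrite pk0 /w /pk; have X0 := sqr_add_gt0 e t0.
have -> : 2 * e * t ^+ 2 / (e ^+ 2 + t ^+ 2) ^+ 2 / e =
          2 * (t ^+ 2 / (e ^+ 2 + t ^+ 2)) / (e ^+ 2 + t ^+ 2).
  by field; rewrite (gt_eqF X0) (gt_eqF e0).
have -> : 2 / t * (t / (e ^+ 2 + t ^+ 2)) = 2 * 1 / (e ^+ 2 + t ^+ 2).
  by field; rewrite (gt_eqF X0) (gt_eqF t0).
rewrite ler_pM2r ?invr_gt0 // ler_pM2l // ler_pdivrMr // mul1r.
by rewrite lerDr sqr_ge0.
Qed.

(** As t -> 0 the mass concentrates at e = 0: beyond any fixed d the weight is O(t^2) with an
    integrable profile. *)
Lemma abel_weight_tail t e d : 0 < d -> d <= e -> w t e <= 4 * t ^+ 2 / d ^+ 2 * pk d (0 - e).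
Proof.
move=> d0 de; have e0 := lt_le_trans d0 de; rewrite pk0.
have X0 : 0 < e ^+ 2 + t ^+ 2 by rewrite addrC sqr_add_gt0.
have Y0 := sqr_add_gt0 e d0.
have -> : 4 * t ^+ 2 / d ^+ 2 * pk d e = t ^+ 2 * (4 / (d * (e ^+ 2 + d ^+ 2))).
  by rewrite /pk; field; rewrite (gt_eqF d0) (gt_eqF Y0).
have -> : w t e = t ^+ 2 * (2 * e / (e ^+ 2 + t ^+ 2) ^+ 2) by rewrite /w; ring.
rewrite ler_wpM2l ?sqr_ge0 // ler_pdivrMr ?exprn_gt0 //.
rewrite [leRHS]mulrAC ler_pdivlMr ?mulr_gt0 //.
have h1 : d ^+ 2 <= e ^+ 2 by rewrite ler_pXn2r ?nnegrE ?(ltW d0) ?(ltW e0).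
have h2 : e ^+ 2 * e ^+ 2 <= (e ^+ 2 + t ^+ 2) ^+ 2.
  by rewrite [leRHS]expr2; apply: ler_pM; rewrite ?sqr_ge0 ?lerDl ?sqr_ge0.
apply: (@le_trans _ _ (4 * (e ^+ 2 * e ^+ 2))); last by rewrite ler_pM2l.
have -> : 4 * (e ^+ 2 * e ^+ 2) = 2 * e * (e * (e ^+ 2 + e ^+ 2)) by ring.
apply: ler_wpM2l; first by rewrite mulr_ge0 ?(ltW e0).
by apply: ler_pM; rewrite ?(ltW d0) ?(ltW Y0) // lerD2l.
Qed.

Lemma abel_weight_derive t e : 0 < t ->
  is_derive e (1 : R) (fun e => e ^+ 2 / (e ^+ 2 + t ^+ 2)) (w t e).
Proof.
move=> t0; have X0 := sqr_add_gt0 e t0.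
have d2 := der_exp 2 (der_id e).
apply: (is_derive_eq (der_mul d2 (der_inv (der_add d2 (der_cst (t ^+ 2) e)) (lt0r_neq0 X0)))).
by rewrite /w /=; field; rewrite gt_eqF.
Qed.

Lemma continuous_abel_weight t : 0 < t -> continuous (w t).
Proof.
move=> t0 e; have X0 := sqr_add_gt0 e t0.
have X2 : (e ^+ 2 + t ^+ 2) ^+ 2 != 0 by rewrite gt_eqF // exprn_gt0.
apply: differentiable_continuous; apply/derivable1_diffP.
by have [] := der_mul (der_mul (der_mul (der_cst 2 e) (der_id e)) (der_cst (t ^+ 2) e))
  (der_inv (der_exp 2 (der_add (der_exp 2 (der_id e)) (der_cst (t ^+ 2) e))) X2).
Qed.

Lemma ig_abel_weight_cut t b : 0 < t ->
  ig (fun e => if (0 < e) && (e < b) then w t e else 0).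
Proof.
move=> t0; apply: (@ig_le _ _ (fun e => pk t (0 - e))).
- apply: measurable_fun_ifT => //; last exact: measurable_abel_weight.
  by apply: measurable_and; apply: measurable_fun_ltr.
- exact: ig_pk.
- move=> e; case: ifP => [/andP[e0 _]|_]; last by rewrite normr0 pk_ge0 ?ltW.
  by rewrite ger0_norm ?abel_weight_ge0 ?abel_weight_le // ltW.
Qed.

Lemma I_abel_weight_cut t b : 0 < t -> 0 <= b ->
  I (fun e => if (0 < e) && (e < b) then w t e else 0) = b ^+ 2 / (b ^+ 2 + t ^+ 2).
Proof.
move=> t0 b0.
have -> : b ^+ 2 / (b ^+ 2 + t ^+ 2) = b ^+ 2 / (b ^+ 2 + t ^+ 2) - 0 ^+ 2 / (0 ^+ 2 + t ^+ 2).
  by rewrite expr0n /= mul0r subr0.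
rewrite -(Rintegral_FTC b0 (continuous_abel_weight t0) (fun e => abel_weight_derive e t0)).
have hi : mu.-integrable `[0, b] (EFin \o w t).
  apply: continuous_compact_integrable; first exact: segment_compact.
  exact/continuous_subspaceT/continuous_abel_weight.
rewrite -Rintegral_itv_obnd_cbnd; last first.
  by apply: integrableS hi => //; apply: subset_itvr; rewrite bnd_simp.
rewrite -Rintegral_itv_bndo_bndc; last first.
  by apply: integrableS hi => //; apply: subset_itv; rewrite bnd_simp.
rewrite [RHS]Rintegral_mkcond; apply: I_ext => e.
by rewrite patchE mem_setE in_itv.
Qed.

Lemma I_abel_weight t : 0 < t ->
  ig (fun e => if 0 < e then w t e else 0) /\ I (fun e => if 0 < e then w t e else 0) = 1.
Proof.
move=> t0; split.
  apply: (@ig_le _ _ (fun e => pk t (0 - e))).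
  - apply: measurable_fun_ifT => //; last exact: measurable_abel_weight.
    by apply: measurable_fun_ltr.
  - exact: ig_pk.
  - move=> e; case: ifP => [e0|_]; last by rewrite normr0 pk_ge0 ?ltW.
    by rewrite ger0_norm ?abel_weight_ge0 ?abel_weight_le // ltW.
pose f_ (n : nat) e := if (0 < e) && (e < n%:R) then w t e else 0.
have [||||_ h] := @dominated_cvgR R f_ (fun e => if 0 < e then w t e else 0) (fun e => pk t (0 - e)).
- by move=> n; exact: ig_measurable (ig_abel_weight_cut _ t0).
- move=> e; apply: cvg_near_cst; near=> n; rewrite /f_.
  suff -> : e < n%:R by rewrite andbT.
  by near: n; exact: nbhs_infty_gtr.
- exact: ig_pk.
- move=> n e; rewrite /f_; case: ifP => [/andP[e0 _]|_]; last by rewrite normr0 pk_ge0 ?ltW.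
  by rewrite ger0_norm ?abel_weight_ge0 ?abel_weight_le // ltW.
have h2 : I (f_ n) @[n --> \oo] --> (1 + 0 : R).
  under eq_fun do rewrite /f_ I_abel_weight_cut //.
  have -> : (fun n : nat => n%:R ^+ 2 / (n%:R ^+ 2 + t ^+ 2)) =
            (fun n : nat => 1 + (0 * (n%:R - 0) - t ^+ 2) / ((n%:R - 0) ^+ 2 + t ^+ 2)) :> (nat -> R).
    apply/funext => n; rewrite !subr0 mul0r sub0r; field.
    by rewrite gt_eqF // sqr_add_gt0.
  have FF : Filter (pinfty_nbhs R) by apply: filter_filter.
  have h5 := @lin_over_quad_cvg R (pinfty_nbhs R) FF 0 t 0 (- t ^+ 2) t0 (near_dist_pinfty 0).
  have h6 : (0 * (n%:R - 0) - t ^+ 2) / ((n%:R - 0) ^+ 2 + t ^+ 2) @[n --> \oo] --> (0 : R).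
    by have := cvg_comp _ _ (@cvgr_idn R) h5.
  by apply: cvgD h6; exact: cvg_cst.
by rewrite -(cvg_lim _ h) // (cvg_lim _ h2) // addr0.
Unshelve. all: by end_near. Qed.

Variables (phi : R -> R) (K : R).
Hypothesis mphi : measurable_fun setT phi.
Hypothesis phiK : forall x, `|phi x| <= K.

Local Notation u := (pext phi).

Let K0 : 0 <= K := bound_ge0 phiK.

Variable x : R.
Let T e := trunc_int (hl_kernel phi x) x e.
(** The guard [0 < e] extends the truncated kernel by 0 to all real e, so that Fubini runs over the
    full plane. *)
Let far e y : R := if (0 < e) && (e < `|x - y|) then hl_kernel phi x y else 0.

Lemma measurable_hl : measurable_fun setT (hl_kernel phi x).
Proof.
apply: measurable_funM; first exact: measurable_funB.
apply: measurableT_comp; first exact: measurable_invr.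
by apply: measurable_funX; exact: measurable_funB.
Qed.

Lemma hl_kernel_le e y : 0 < e -> e < `|x - y| ->
  `|hl_kernel phi x y| <= 4 * K / e * pk e (x - y).
Proof.
move=> e0 ey; have X0 := sqr_add_gt0 (x - y) e0.
have h0 : 0 < (x - y) ^+ 2.
  by rewrite -(real_normK (num_real _)) exprn_gt0 // (lt_trans e0).
have h1 : e ^+ 2 <= (x - y) ^+ 2.
  by rewrite -[leRHS](real_normK (num_real _)) ler_pXn2r ?nnegrE // ltW.
rewrite /hl_kernel normrM normfV (gtr0_norm h0) ler_pdivrMr //.
have -> : 4 * K / e * pk e (x - y) * (x - y) ^+ 2 =
    2 * K * (2 * (x - y) ^+ 2 / ((x - y) ^+ 2 + e ^+ 2)).
  by rewrite /pk; field; rewrite (gt_eqF e0) (gt_eqF X0).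
have h2 : 1 <= 2 * (x - y) ^+ 2 / ((x - y) ^+ 2 + e ^+ 2).
  by rewrite ler_pdivlMr // mul1r; lra.
have h3 : `|phi x - phi y| <= 2 * K.
  rewrite (le_trans (ler_normB _ _)) //.
  by have := phiK x; have := phiK y; lra.
by rewrite (le_trans h3) // ler_peMr // mulr_ge0.
Qed.

Lemma measurable_far e : measurable_fun setT (far e).
Proof.
apply: measurable_fun_ifT => //; last exact: measurable_hl.
apply: measurable_and => //; apply: measurable_fun_ltr => //.
by apply: measurableT_comp => //; exact: measurable_funB.
Qed.

Lemma far_le e y : 0 < e -> `|far e y| <= 4 * K / e * pk e (x - y).
Proof.
move=> e0; rewrite /far e0 /=; case: ifP => ey; first exact: hl_kernel_le.
by rewrite normr0 mulr_ge0 ?pk_ge0 ?divr_ge0 ?mulr_ge0 // ltW.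
Qed.

Lemma ig_far e : 0 < e -> ig (far e).
Proof.
move=> e0; apply: ig_le (measurable_far e) (igZ (4 * K / e) (ig_pk x e0)) _.
by move=> y; exact: far_le.
Qed.

Lemma trunc_far e : 0 < e -> T e = I (far e).
Proof.
move=> e0; rewrite /T /trunc_int Rintegral_mkcond; apply: I_ext => y.
by rewrite patchE /far e0 /= mem_setE.
Qed.

Lemma trunc_bound e : 0 < e -> `|T e| <= 4 * K * pi / e.
Proof.
move=> e0; rewrite trunc_far //.
have -> : 4 * K * pi / e = 4 * K / e * pi by ring.
rewrite -(I_pk x e0) -IZ; last exact: ig_pk.
apply: I_norm_le; [exact: ig_far|exact/igZ/ig_pk|move=> y; exact: far_le].
Qed.

(** Fubini in (e, y): integrating in y first gives the truncated integrals, integrating the weight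
    over 0 < e < |x - y| first gives (phi x - phi y) [pk t (x - y)] / t. *)
Lemma abel_identity t : 0 < t ->
  ig (fun e => if 0 < e then w t e * T e else 0) /\
  (pi * phi x - u x t) / t = I (fun e => if 0 < e then w t e * T e else 0).
Proof.
move=> t0; pose f e y := w t e * far e y.
have e1 e : I (f e) = if 0 < e then w t e * T e else 0.
  rewrite /f; case: ifPn => [e0|]; first by rewrite (IZ _ (ig_far e0)) trunc_far.
  rewrite -leNgt => e0; rewrite (I_ext (g := fun=> 0)) ?Rintegral_cst ?mul0r //.
  by move=> y; rewrite /far ltNge e0 /= mulr0.
have e2 y : I (f^~ y) = t^-1 * (phi x * pk t (x - y) - phi y * pk t (x - y)).
  transitivity (I (fun e => hl_kernel phi x y *
      (if (0 < e) && (e < `|x - y|) then w t e else 0))).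
    by apply: I_ext => e; rewrite /f /far; case: ifP => _; rewrite ?mulr0 // mulrC.
  rewrite (IZ _ (ig_abel_weight_cut `|x - y| t0)) I_abel_weight_cut //.
  rewrite real_normK ?num_real // /hl_kernel /pk.
  have X0 := sqr_add_gt0 (x - y) t0.
  have [->|xy] := eqVneq x y; first by rewrite !subrr !mul0r mulr0.
  by field; rewrite (gt_eqF t0) (gt_eqF X0) subr_eq0 xy.
have [|||||h1 h2] := @Rintegral_Fubini R _ _ _ _ mu mu f (fun e => 8 * K * pi / t * pk t (0 - e)).
- apply: measurable_funM; first exact: (measurableT_comp (measurable_abel_weight t)).
  apply: measurable_fun_ifT => //; last exact: (measurableT_comp measurable_hl).
  apply: measurable_and => //; apply: measurable_fun_ltr => //.
  by apply: measurableT_comp => //; exact: measurable_funB.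
- move=> e; have [e0|e0] := ltP 0 e; first exact/igZ/ig_far.
  apply: ig_ext (igZ 0 (ig_pk x t0)) => y.
  by rewrite /f /far ltNge e0 /= mul0r mulr0.
- move=> y; apply: ig_ext (igZ (hl_kernel phi x y) (ig_abel_weight_cut `|x - y| t0)) => e.
  by rewrite /f /far; case: ifP => _; rewrite ?mulr0 // mulrC.
- exact/igZ/ig_pk.
- move=> e; have [e0|e0] := ltP 0 e; last first.
    rewrite (I_ext (g := fun=> 0)) ?Rintegral_cst ?mul0r.
    + apply: mulr_ge0; last exact/pk_ge0/ltW.
      by apply: divr_ge0 (ltW t0); rewrite !mulr_ge0 ?pi_ge0.
    + by [].
    + by move=> y; rewrite /f /far ltNge e0 /= mulr0 normr0.
  have w0 : 0 <= w t e by rewrite abel_weight_ge0 // ltW.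
  apply: (@le_trans _ _ (I (fun y => w t e * (4 * K / e) * pk e (x - y)))).
    apply: I_le; [by apply/ig_norm/igZ/ig_far|exact/igZ/ig_pk|].
    by move=> y; rewrite /f normrM ger0_norm // -mulrA ler_wpM2l // far_le.
  rewrite (IZ _ (ig_pk x e0)) I_pk //.
  have -> : w t e * (4 * K / e) * pi = 4 * K * pi * (w t e / e) by ring.
  have -> : 8 * K * pi / t * pk t (0 - e) = 4 * K * pi * (2 / t * pk t (0 - e)) by ring.
  by rewrite ler_wpM2l ?abel_weight_div_le // !mulr_ge0 ?pi_ge0.
split; first by apply: ig_ext h1 => e; rewrite e1.
rewrite -(I_ext e1) h2 {h1 h2}.
have g1 := ig_pk x t0; have g2 := ig_phi mphi phiK g1.
rewrite (I_ext e2) (IZ _ (igB (igZ (phi x) g1) g2)) (IB (igZ (phi x) g1) g2) (IZ _ g1).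
by rewrite I_pk // mulrC (mulrC pi).
Qed.

(** An Abelian theorem: the weights are nonnegative, have mass 1 and concentrate at 0, so the
    averages of the truncated integrals inherit their limit. *)
Lemma poisson_normal_derivative L : PV_at (hl_kernel phi x) x L ->
  (pi * phi x - u x t) / t @[t --> 0^'+] --> L.
Proof.
move=> hL; apply/cvgrPdist_le => /= e e0.
have e20 : 0 < e / 2 by rewrite divr_gt0.
have [d /= d0 hd] : exists2 d, 0 < d & forall r, 0 < r -> r < d -> `|L - T r| <= e / 2.
  have /cvgrPdist_le /(_ _ e20) [d /= d0 hd] := hL.
  exists d => // r r0 rd; apply: hd => //=.
  by rewrite sub0r normrN gtr0_norm.
(* M bounds |L - T r| for r >= d; C - 1 is the constant in the O(t^2) tail contribution. *)
pose M := 4 * K * pi / d + `|L|.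
have M0 : 0 <= M.
  by rewrite addr_ge0 // divr_ge0 ?(ltW d0) // !mulr_ge0 ?pi_ge0.
pose C := M * 4 / d ^+ 2 * pi + 1.
have C0 : 0 < C.
  by rewrite ltr_wpDl // !mulr_ge0 ?invr_ge0 ?sqr_ge0 ?pi_ge0.
near=> t; have t0 : 0 < t by near: t; exact: nbhs_right_gt.
have t1 : t <= 1 by near: t; apply: nbhs_right_le.
have tC : t <= e / 2 / C by near: t; apply: nbhs_right_le; rewrite divr_gt0.
have [h1 ->] := abel_identity t0; have [h2 h3] := I_abel_weight t0.
have -> : L = I (fun r => L * (if 0 < r then w t r else 0)) by rewrite IZ // h3 mulr1.
have h4 := igD (igZ (e / 2) h2) (igZ (M * (4 * t ^+ 2 / d ^+ 2)) (ig_pk 0 d0)).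
rewrite -(IB (igZ L h2) h1).
apply: (le_trans (I_norm_le (igB (igZ L h2) h1) h4 _)).
  move=> r; have P0 := pk_ge0 (0 - r) (ltW d0).
  have Q0 : 0 <= M * (4 * t ^+ 2 / d ^+ 2).
    by rewrite !mulr_ge0 ?invr_ge0 ?sqr_ge0.
  case: ifPn => r0; last by rewrite !mulr0 subrr normr0 add0r mulr_ge0.
  have w0 : 0 <= w t r by rewrite abel_weight_ge0 // ltW.
  rewrite mulrC -mulrBr normrM ger0_norm //.
  have [rd|dr] := ltP r d.
    apply: (@le_trans _ _ (e / 2 * w t r)); last by rewrite lerDl mulr_ge0.
    by rewrite mulrC ler_wpM2r // hd.
  apply: (@le_trans _ _ (M * (4 * t ^+ 2 / d ^+ 2) * pk d (0 - r))); last first.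
    by rewrite lerDr mulr_ge0 // ltW.
  rewrite mulrC -mulrA; apply: ler_pM => //; last exact: abel_weight_tail.
  rewrite (le_trans (ler_normB _ _)) // addrC lerD2r (le_trans (trunc_bound r0)) //.
  by rewrite ler_wpM2l ?mulr_ge0 ?pi_ge0 // lef_pV2.
rewrite (ID (igZ (e / 2) h2) (igZ _ (ig_pk 0 d0))) (IZ _ h2) (IZ _ (ig_pk 0 d0)) h3 I_pk // mulr1.
have -> : M * (4 * t ^+ 2 / d ^+ 2) * pi = (C - 1) * t * t.
  by rewrite /C; field; rewrite gt_eqF.
have : (C - 1) * t * t <= C * t.
  have : 0 <= C - 1.
    by rewrite /C addrK !mulr_ge0 ?invr_ge0 ?sqr_ge0 ?pi_ge0.
  move=> g1; have g2 : (C - 1) * t * t <= (C - 1) * t by rewrite ler_piMr // mulr_ge0 // ltW.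
  by lra.
have : C * t <= e / 2 by rewrite mulrC -ler_pdivlMr.
by lra.
Unshelve. all: by end_near. Qed.

End abel_summation.

(** * From pointwise to uniform normal bounds *)

Section normal_bound.
Context {R : realType}.
Notation mu := (@lebesgue_measure R).
Notation ig f := (mu.-integrable setT (EFin \o f)).
Notation I f := (Rintegral mu setT f).
Variables (phi G : R -> R) (K C : R).
Hypothesis mphi : measurable_fun setT phi.
Hypothesis phiK : forall x, `|phi x| <= K.
Hypothesis phiG : forall x, PV_at (hl_kernel phi x) x (G x).
Hypothesis GC : forall x, `|G x| <= C.

Local Notation u := (pext phi).
Local Notation V := (vext phi).

Let K0 : 0 <= K := bound_ge0 phiK.
Let C0 : 0 <= C := le_trans (normr_ge0 (G 0)) (GC 0).
Let pi0 : 0 < pi :> R := pi_gt0 R.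
Let Kpi0 : 0 <= K * pi := mulr_ge0 K0 (ltW pi0).

Lemma vext_le x t : 0 <= t -> `|V x t| <= K * pi * t.
Proof.
move=> t0; have := @vext_dist R phi K mphi phiK x 0 t 0 (K * pi) (lexx 0) t0.
rewrite vext0 mul0r !subr0; apply => s /andP[/ltW s0 _].
by rewrite subr0; exact: (pext_le mphi phiK).
Qed.

Lemma ig_pk_vext x r t : 0 <= r -> 0 < t -> ig (fun y => V y r * pk t (x - y)).
Proof.
move=> r0 t0; apply: (igM_bounded (k := K * pi * r)) (ig_pk x t0).
  by apply: continuous_measurable_fun; exact: continuous_vext.
by move=> y; exact: vext_le.
Qed.

Let vext_increment x t : 0 <= t -> `|V x (1 + t) - V x 1 - u x 1 * t| <= K * pi * t * t.
Proof.
move=> t0; have t1 : 1 <= 1 + t by rewrite lerDl.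
have := @vext_dist R phi K mphi phiK x 1 (1 + t) (u x 1) (K * pi * t) ler01 t1.
rewrite (_ : 1 + t - 1 = t); last by ring.
apply => s /andP[/ltW s1 st].
rewrite (le_trans (pext_lip_time mphi phiK x ltr01 s1)) // divr1 ler_wpM2l //.
by lra.
Qed.

(** The range e depends on the speed of convergence of the normal derivative at x; the constant C +
    1 does not, because C bounds all these derivatives. *)
Let vext_near0 x : exists2 e, 0 < e &
  forall t, 0 < t -> t < e -> `|V x t - pi * phi x * t| <= (C + 1) * t * t.
Proof.
have := poisson_normal_derivative mphi phiK (@phiG x).
move=> /cvgrPdist_le /(_ 1 ltr01) [e /= e0 he]; exists e => // t t0 te.
have := @vext_dist R phi K mphi phiK x 0 t (pi * phi x) ((C + 1) * t) (lexx 0) (ltW t0).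
rewrite vext0 !subr0; apply => s /andP[s0 st].
have := he s; rewrite /= sub0r normrN gtr0_norm // => /(_ (le_lt_trans st te) s0) h.
have hs : `|(pi * phi x - u x s) / s| <= C + 1.
  have := ler_normD (G x) (- (G x - (pi * phi x - u x s) / s)).
  rewrite normrN opprB addrC subrK => /le_trans; apply.
  by rewrite lerD.
rewrite distrC -[_ - _](divfK (lt0r_neq0 s0)) normrM (gtr0_norm s0).
by apply: ler_pM => //; exact: ltW.
Qed.

Let quot_vext x t : 0 < t ->
  poisson_quot (V ^~ 1) x t = pi / t * (V x (1 + t) - V x t - V x 1).
Proof.
move=> t0; rewrite /poisson_quot.
have h1 := ig_pk_vext x ler01 t0; have h2 := igZ (V x 1) (ig_pk x t0).
rewrite (I_ext (g := fun y => V y 1 * pk t (x - y) - V x 1 * pk t (x - y))); last first.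
  by move=> y; rewrite mulrBl.
rewrite (IB h1 h2) (IZ (V x 1) (ig_pk x t0)) (I_pk x t0) {h1 h2}.
rewrite (I_ext (g := fun y => pk t (x - y) * V y 1)); last by move=> y; rewrite mulrC.
by rewrite (poisson_vext mphi phiK x ler01 t0); ring.
Qed.

(** The deviation of the quotient from pi (u x 1 - pi phi x) is the difference of two Taylor
    remainders of V x: at height 1, where u is Lipschitz, and at height 0, where only [vext_near0]
    is available. *)
Let quot_vext_dist x t : 0 < t ->
  poisson_quot (V ^~ 1) x t - pi * (u x 1 - pi * phi x) =
  pi / t * (V x (1 + t) - V x 1 - u x 1 * t - (V x t - pi * phi x * t)).
Proof. by move=> t0; rewrite quot_vext //; field; rewrite gt_eqF. Qed.

(* The Poisson quotient of V(., 1) at height t is pi / t (V(1 + t) - V(t) - V(1)), so a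
   uniform bound on it is one on V(t). *)
Lemma vext_quadratic : exists2 B, 0 <= B &
  forall x t, 0 < t -> `|V x t - pi * phi x * t| <= B * t * t.
Proof.
pose B := pi * (K * pi + (C + 1)).
have B0 : 0 <= B by rewrite mulr_ge0 ?(ltW pi0) // !addr_ge0.
have hq x t : 0 < t -> `|poisson_quot (V ^~ 1) x t - pi * (u x 1 - pi * phi x)| <= (3 * B + 1) * pi * t.
  apply: (@poisson_quot_bound _ (V ^~ 1) (fun x => pi * (u x 1 - pi * phi x)) (K * pi)) => //.
  - exact: (continuous_vext mphi phiK).
  - by move=> y; have := vext_le y ler01; rewrite mulr1.
  move=> y; have [e e0 he] := vext_near0 y; exists e => // s s0 se.
  rewrite quot_vext_dist // normrM gtr0_norm ?divr_gt0 // /B.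
  have -> : pi * (K * pi + (C + 1)) * s = pi / s * (K * pi * s * s + (C + 1) * s * s).
    by field; rewrite gt_eqF.
  rewrite ler_wpM2l ?divr_ge0 ?(ltW pi0) ?(ltW s0) // (le_trans (ler_normB _ _)) //.
  by rewrite lerD ?he // vext_increment // ltW.
exists (K * pi + (3 * B + 1)).
  by rewrite !addr_ge0 // mulr_ge0.
move=> x t t0; have := hq x t t0; rewrite quot_vext_dist // normrM gtr0_norm ?divr_gt0 //.
have -> : (3 * B + 1) * pi * t = pi / t * ((3 * B + 1) * t * t).
  by field; rewrite gt_eqF.
rewrite ler_pM2l ?divr_gt0 // => h.
have := vext_increment x (ltW t0); move: h; rewrite !ler_norml => /andP[? ?] /andP[? ?].
by apply/andP; split; lra.
Qed.

(** Averaging the quadratic bound with [pk t] yields t u(x, t) = V(2t) - V(t) + O(B t^2), so u is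
    recovered from its primitive without differentiating. The constant is 6 = 4 + 1 + 1: the bounds
    at 2t and at t, and the averaging. *)
Lemma pext_normal_bound : exists2 B, 0 <= B &
  forall x t, 0 < t -> `|pi * phi x - u x t| <= B * t.
Proof.
have [B B0 hB] := vext_quadratic; exists (6 * B); first by rewrite mulr_ge0.
move=> x t t0.
have g1 := ig_phi mphi phiK (ig_pk x t0); have g2 := ig_pk_vext x (ltW t0) t0.
have e : I (fun y => (V y t - pi * phi y * t) * pk t (x - y)) =
    pi * (V x (t + t) - V x t - t * u x t).
  rewrite (I_ext (g := fun y => V y t * pk t (x - y) - (pi * t) * (phi y * pk t (x - y)))); last first.
    by move=> y; ring.
  rewrite (IB g2 (igZ _ g1)) (IZ _ g1) -/(u x t).
  rewrite (I_ext (g := fun y => pk t (x - y) * V y t)); last by move=> y; rewrite mulrC.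
  by rewrite (poisson_vext mphi phiK x (ltW t0) t0); ring.
have h1 : `|V x (t + t) - V x t - t * u x t| <= B * t * t.
  have : `|I (fun y => (V y t - pi * phi y * t) * pk t (x - y))| <= B * t * t * pi.
    rewrite -[X in _ <= _ * X](I_pk x t0) -IZ; last exact: ig_pk.
    apply: I_norm_le; last first.
    - move=> y; rewrite normrM (ger0_norm (pk_ge0 (x - y) (ltW t0))).
      by apply: ler_wpM2r (hB y t t0); exact/pk_ge0/ltW.
    - exact/igZ/ig_pk.
    - apply: ig_ext (igB g2 (igZ (pi * t) g1)) => y; ring.
  by rewrite e normrM gtr0_norm // mulrC ler_pM2r.
have tt0 : 0 < t + t by rewrite addr_gt0.
rewrite -(ler_pM2r t0) -[X in _ * X <= _](gtr0_norm t0) -normrM.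
have := hB x _ tt0; have := hB x t t0; move: h1.
rewrite !ler_norml => /andP[? ?] /andP[? ?] /andP[? ?].
by apply/andP; split; lra.
Qed.

End normal_bound.

(** * Weak formulation *)

Section weak_formulation.
Context {R : realType}.
Notation mu := (@lebesgue_measure R).
Notation ig f := (mu.-integrable setT (EFin \o f)).
Notation I f := (Rintegral mu setT f).
Implicit Types (al be a s t r x y : R).

(* The s-derivative of [rk al be a s], and its difference quotient below. *)
Definition drk al be a s y : R :=
  (be * ((y - a) ^+ 2 - s ^+ 2) - 2 * al * s * (y - a)) / ((y - a) ^+ 2 + s ^+ 2) ^+ 2.

Definition rk_quot al be a s t y : R :=
  (be * ((y - a) ^+ 2 + s ^+ 2) - (al * (y - a) + be * s) * (2 * s + t)) /
  (((y - a) ^+ 2 + s ^+ 2) * ((y - a) ^+ 2 + (s + t) ^+ 2)).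

Lemma rk_increment al be a s t y : 0 < s -> 0 <= t ->
  rk al be a (s + t) y - rk al be a s y = t * rk_quot al be a s t y.
Proof.
move=> s0 t0; have X0 := sqr_add_gt0 (y - a) s0.
have Y0 := sqr_add_gt0 (y - a) (ltr_wpDr t0 s0).
by rewrite /rk /rk_quot; field; rewrite (gt_eqF X0) (gt_eqF Y0).
Qed.

Lemma rk_quot_le al be a s t y : 0 < s -> 0 <= t ->
  `|rk_quot al be a s t y| <= (`|be| + (`|al| + `|be|) / s * (2 * s + t)) / s * pk s (a - y).
Proof.
move=> s0 t0; have st0 := ltr_wpDr t0 s0.
have X0 := sqr_add_gt0 (y - a) s0; have Y0 := sqr_add_gt0 (y - a) st0.
have -> : rk_quot al be a s t y =
  (be - rk al be a s y * (2 * s + t)) / ((y - a) ^+ 2 + (s + t) ^+ 2).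
  by rewrite /rk /rk_quot; field; rewrite (gt_eqF X0) (gt_eqF Y0).
rewrite pk_sym.
have -> : forall c, c / s * pk s (y - a) = c / ((y - a) ^+ 2 + s ^+ 2).
  by move=> c; rewrite /pk; field; rewrite (gt_eqF X0) (gt_eqF s0).
have c0 : 0 <= 2 * s + t by rewrite addr_ge0 // mulr_ge0 // ltW.
rewrite normrM normfV (gtr0_norm Y0); apply: ler_pM => //; first by rewrite invr_ge0 ltW.
  rewrite (le_trans (ler_normB _ _)) // lerD2l normrM (ger0_norm c0) ler_wpM2r //.
  exact: rk_le.
rewrite lef_pV2 ?posrE // lerD2l ler_pXn2r ?nnegrE ?(ltW s0) ?(ltW st0) //.
by rewrite lerDl.
Qed.

Lemma drk_le al be a s y : 0 < s -> `|drk al be a s y| <= (`|al| + `|be|) / s * pk s (a - y).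
Proof.
move=> s0; have X0 := sqr_add_gt0 (y - a) s0.
have -> : (`|al| + `|be|) / s * pk s (a - y) = (`|al| + `|be|) * ((y - a) ^+ 2 + s ^+ 2) / ((y - a) ^+ 2 + s ^+ 2) ^+ 2.
  by rewrite pk_sym /pk; field; rewrite (gt_eqF X0) (gt_eqF s0).
rewrite /drk normrM normfV (gtr0_norm (exprn_gt0 2 X0)) ler_pM2r ?invr_gt0 ?exprn_gt0 //.
rewrite (le_trans (ler_normB _ _)) // [leLHS]addrC [leRHS]mulrDl lerD //.
  rewrite -!mulrA mulrCA normrM ler_wpM2l // normrM gtr0_norm // normrM (gtr0_norm s0).
  have := sqr_ge0 (`|y - a| - s); rewrite sqrrB -normrX (ger0_norm (sqr_ge0 _)).
  by move=> ?; lra.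
rewrite normrM ler_wpM2l // (le_trans (ler_normB _ _)) //.
by rewrite !ger0_norm ?sqr_ge0.
Qed.

Lemma measurable_rk_quot al be a s t : measurable_fun setT (rk_quot al be a s t).
Proof.
have mq : measurable_fun setT (fun y => (y - a) ^+ 2).
  by apply: measurable_funX; exact: measurable_funB.
apply: measurable_funM.
  apply: measurable_funB; apply: measurable_funM => //; first exact: measurable_funD.
  by apply: measurable_funD => //; apply: measurable_funM => //; exact: measurable_funB.
apply: measurableT_comp; first exact: measurable_invr.
by apply: measurable_funM; apply: measurable_funD.
Qed.

Lemma measurable_drk al be a s : measurable_fun setT (drk al be a s).
Proof.
have mq : measurable_fun setT (fun y => (y - a) ^+ 2).
  by apply: measurable_funX; exact: measurable_funB.
apply: measurable_funM.
  apply: measurable_funB; apply: measurable_funM => //; exact: measurable_funB.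
apply: measurableT_comp; first exact: measurable_invr.
by apply: measurable_funX; apply: measurable_funD.
Qed.

Lemma ig_drk al be a s : 0 < s -> ig (drk al be a s).
Proof.
move=> s0; apply: ig_le (measurable_drk al be a s) (igZ ((`|al| + `|be|) / s) (ig_pk a s0)) _.
by move=> y; exact: drk_le.
Qed.

Lemma ig_rk_quot al be a s t : 0 < s -> 0 <= t -> ig (rk_quot al be a s t).
Proof.
move=> s0 t0; apply: ig_le (measurable_rk_quot al be a s t)
  (igZ ((`|be| + (`|al| + `|be|) / s * (2 * s + t)) / s) (ig_pk a s0)) _.
by move=> y; exact: rk_quot_le.
Qed.

Lemma rk_quot_cvg (t_ : nat -> R) al be a s y : 0 < s -> t_ n @[n --> \oo] --> (0 : R) ->
  rk_quot al be a s (t_ n) y @[n --> \oo] --> drk al be a s y.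
Proof.
move=> s0 ht; have X0 := sqr_add_gt0 (y - a) s0.
have -> : drk al be a s y =
    (be * ((y - a) ^+ 2 + s ^+ 2) - (al * (y - a) + be * s) * (2 * s + 0)) /
      (((y - a) ^+ 2 + s ^+ 2) * ((y - a) ^+ 2 + (s + 0) * (s + 0))).
  by rewrite /drk !addr0; field; rewrite gt_eqF // -expr2.
rewrite /rk_quot.
have hs c : c + t_ n @[n --> \oo] --> c + 0 by apply: cvgD => //; exact: cvg_cst.
apply: cvgM.
  by apply: cvgB; [exact: cvg_cst|apply: cvgM; [exact: cvg_cst|exact: hs]].
apply: cvgV; first by rewrite addr0 -expr2 gt_eqF // mulr_gt0.
apply: cvgM; first exact: cvg_cst.
by apply: cvgD; [exact: cvg_cst|apply: cvgM; exact: hs].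
Qed.

Variables (phi G : R -> R) (K B : R).
Hypothesis mphi : measurable_fun setT phi.
Hypothesis phiK : forall x, `|phi x| <= K.
Hypothesis phiG : forall x, PV_at (hl_kernel phi x) x (G x).
Hypothesis B0 : 0 <= B.
Hypothesis phiB : forall x t, 0 < t -> `|pi * phi x - pext phi x t| <= B * t.

Local Notation u := (pext phi).

(** The condition t < s keeps t away from s and s + d, the degenerate heights of [poisson_rk]. *)
Lemma I_rk_pext al be a s d t : 0 < s -> 0 < d -> 0 < t -> t < s ->
  let psi y := rk al be a (s + d) y - rk al be a s y in
  ig (fun y => psi y * u y t) /\
  I (fun y => psi y * u y t) = pi * I (fun z => phi z *
    (rk al be a (s + d + t) z - rk al be a (s + t) z)).
Proof.
move=> s0 d0 t0 ts psi; have sd0 : 0 < s + d by rewrite addr_gt0.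
have st0 : 0 < s + t by rewrite addr_gt0.
have hpsi : ig psi.
  apply: ig_ext (igZ d (ig_rk_quot al be a s0 (ltW d0))) => y.
  by rewrite /psi rk_increment // ltW.
have [h1 h2] := pext_fubini mphi phiK t0 hpsi; split; [exact: h1|].
rewrite h2 {h1 h2} -IZ; last first.
  apply: (ig_phi mphi phiK).
  apply: ig_ext (igZ d (ig_rk_quot al be a st0 (ltW d0))) => y.
  by rewrite -rk_increment ?(ltW d0) // addrAC.
apply: I_ext => z; rewrite mulrCA; congr (_ * _).
have g c (c0 : 0 < c) := ig_mul_rk al be a c0 (ig_pk z t0).
rewrite mulrBr -!poisson_rk ?(gt_eqF ts) ?orbT //; last first.
  have sdt : t < s + d by apply: lt_trans ts _; rewrite ltrDl.
  by rewrite (gt_eqF sdt) orbT.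
rewrite -IB; [|exact: g|exact: g].
by apply: I_ext => y; rewrite (pk_sym t y z) /psi; ring.
Qed.

(** The difference quotient of u in height is moved onto the test function, where the Poisson
    operator just raises the height of [rk]. Both sides converge by dominated convergence; on the
    side of phi the majorant is the uniform bound [phiB]. *)
Lemma weak_rk_increment al be a s d : 0 < s -> 0 < d ->
  I (fun y => (rk al be a (s + d) y - rk al be a s y) * G y) =
  - pi * I (fun y => phi y * (drk al be a (s + d) y - drk al be a s y)).
Proof.
move=> s0 d0; have sd0 : 0 < s + d by rewrite addr_gt0.
pose psi y := rk al be a (s + d) y - rk al be a s y.
have hpsi : ig psi.
  apply: ig_ext (igZ d (ig_rk_quot al be a s0 (ltW d0))) => y.
  by rewrite /psi rk_increment // ltW.
have mpsi := ig_measurable hpsi.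
(* The factor s / 2 keeps every term below s, as [I_rk_pext] requires. *)
pose t_ (n : nat) : R := s / 2 * n.+1%:R^-1.
have t0 n : 0 < t_ n by rewrite mulr_gt0 ?divr_gt0 ?invr_gt0.
have ts n : t_ n < s.
  apply: (@le_lt_trans _ _ (s / 2)); last lra.
  by rewrite ler_piMr ?divr_ge0 ?(ltW s0) // invf_le1 // ler1n.
have t_cvg : t_ n @[n --> \oo] --> (0 : R).
  rewrite -[X in _ --> X](mulr0 (s / 2)); apply: cvgM; first exact: cvg_cst.
  exact: cvg_harmonic.
pose f n y := psi y * ((pi * phi y - u y (t_ n)) / t_ n).
have mu_ n : measurable_fun setT (u ^~ (t_ n)).
  by apply: continuous_measurable_fun; exact: (continuous_pext_space mphi phiK).
have [||||_ c1] := @dominated_cvgR R f (fun y => psi y * G y) (fun y => B * `|psi y|).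
- move=> n; apply: measurable_funM => //; apply: measurable_funM => //.
  by apply: measurable_funB => //; exact: measurable_funM.
- move=> y; apply: cvgM; first exact: cvg_cst.
  have /cvg_at_rightP h := poisson_normal_derivative mphi phiK (@phiG y).
  exact: (h t_ (conj t0 t_cvg)).
- exact/igZ/ig_norm.
- move=> n y; rewrite /f normrM mulrC ler_wpM2r // normrM normfV (gtr0_norm (t0 n)).
  by rewrite ler_pdivrMr // phiB.
pose g n y := phi y * (rk_quot al be a (s + d) (t_ n) y - rk_quot al be a s (t_ n) y).
pose c r := (`|be| + (`|al| + `|be|) / r * (2 * r + s)) / r.
have mg n : measurable_fun setT (g n).
  apply: measurable_funM => //.
  by apply: measurable_funB; exact: measurable_rk_quot.
have hq r n y : 0 < r -> `|rk_quot al be a r (t_ n) y| <= c r * pk r (a - y).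
  move=> r0; rewrite (le_trans (rk_quot_le al be a y r0 (ltW (t0 n)))) //.
  apply: ler_wpM2r; first exact/pk_ge0/ltW.
  rewrite ler_pM2r ?invr_gt0 // lerD2l ler_wpM2l ?lerD2l ?(ltW (ts n)) //.
  by rewrite divr_ge0 ?addr_ge0 // ltW.
have [||||_ c2] := @dominated_cvgR R g (fun y => phi y * (drk al be a (s + d) y - drk al be a s y))
  (fun y => K * (c (s + d) * pk (s + d) (a - y) + c s * pk s (a - y))).
- by [].
- move=> y; apply: cvgM; first exact: cvg_cst.
  by apply: cvgB; exact: rk_quot_cvg.
- by apply: igZ; apply: igD; apply/igZ/ig_pk.
- move=> n y; rewrite /g normrM ler_pM // (le_trans (ler_normB _ _)) // lerD //; exact: hq.
have e n : I (f n) = - pi * I (g n).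
  have [h1 h2] := I_rk_pext al be a s0 d0 (t0 n) (ts n).
  have h3 := ig_phi mphi phiK hpsi.
  have st0 : 0 < s + t_ n by rewrite addr_gt0.
  have h4 : ig (fun z => phi z * (rk al be a (s + d + t_ n) z - rk al be a (s + t_ n) z)).
    apply: (ig_phi mphi phiK).
    apply: ig_ext (igZ d (ig_rk_quot al be a st0 (ltW d0))) => y.
    by rewrite -rk_increment ?(ltW d0) // addrAC.
  rewrite (I_ext (g := fun y => (t_ n)^-1 * (pi * (phi y * psi y) - psi y * u y (t_ n)))); last first.
    by move=> y; rewrite /f; ring.
  rewrite (IZ _ (igB (igZ pi h3) h1)) (IB (igZ pi h3) h1) (IZ _ h3) h2 -mulrBr -(IB h3 h4).
  rewrite mulrCA mulNr -mulrN; congr (_ * _); rewrite -(IZ _ (igB h3 h4)) -mulN1r -IZ.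
    apply: I_ext => y; rewrite /g /psi.
    have := rk_increment al be a y sd0 (ltW (t0 n)).
    have := rk_increment al be a y s0 (ltW (t0 n)).
    move=> e1 e2; apply: (mulIf (lt0r_neq0 (t0 n))).
    have -> : -1 * (phi y * (rk_quot al be a (s + d) (t_ n) y - rk_quot al be a s (t_ n) y)) * t_ n =
      phi y * (t_ n * rk_quot al be a s (t_ n) y - t_ n * rk_quot al be a (s + d) (t_ n) y) by ring.
    by rewrite -e1 -e2; field; exact: lt0r_neq0.
  apply: (ig_phi mphi phiK); apply: igB; apply: ig_rk_quot => //; exact: ltW.
have c3 : I (f n) @[n --> \oo] -->
    - pi * I (fun y => phi y * (drk al be a (s + d) y - drk al be a s y)).
  by under eq_fun do rewrite e; apply: cvgM => //; exact: cvg_cst.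
by rewrite -(cvg_lim _ c1) // (cvg_lim _ c3).
Qed.

Hypothesis iG : ig G.

(* [rk] itself is not integrable, but its s-increments are; the boundary term at
   s + d vanishes as d tends to infinity. *)
Lemma weak_rk al be a s : 0 < s ->
  I (fun y => rk al be a s y * G y) = - pi * I (fun y => phi y * drk al be a s y).
Proof.
move=> s0; pose c := `|al| + `|be|; have c0 : 0 <= c by rewrite addr_ge0.
have K0 := bound_ge0 phiK; have pi0 : 0 < pi :> R := pi_gt0 R.
have g1 r : 0 < r -> ig (fun y => rk al be a r y * G y).
  by move=> r0; apply: igM_bounded (measurable_rk al be a r) _ iG => y; exact: rk_le.
have g2 r : 0 < r -> ig (fun y => phi y * drk al be a r y).
  by move=> r0; apply/(ig_phi mphi phiK)/ig_drk.
have b1 r : 0 < r -> `|I (fun y => rk al be a r y * G y)| <= c / r * I (fun y => `|G y|).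
  move=> r0; rewrite -(IZ _ (ig_norm iG)); apply: I_norm_le; [exact: g1|exact/igZ/ig_norm|].
  by move=> y; rewrite normrM ler_wpM2r //; exact: rk_le.
have b2 r : 0 < r -> `|I (fun y => phi y * drk al be a r y)| <= K * (c / r) * pi.
  move=> r0; rewrite -[X in _ <= _ * X](I_pk a r0) -(IZ _ (ig_pk a r0)).
  apply: I_norm_le; [exact: g2|exact/igZ/ig_pk|].
  by move=> y; rewrite normrM -mulrA ler_pM //; exact: drk_le.
apply/eqP; rewrite -subr_eq0 -normr_le0; apply/ler_addgt0Pl => e e0; rewrite addr0.
(* Both boundary terms at s + d are bounded by N / (s + d) in total; d is then chosen to bring this
   below e. *)
pose N := c * I (fun y => `|G y|) + pi * (K * c * pi).
have N0 : 0 <= N.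
  by rewrite addr_ge0 // !mulr_ge0 ?(ltW pi0) // Rintegral_ge0.
pose d := (N + 1) / e.
have d0 : 0 < d by rewrite divr_gt0 // ltr_wpDl.
have sd0 : 0 < s + d by rewrite addr_gt0.
have := weak_rk_increment al be a s0 d0.
rewrite (I_ext (g := fun y => rk al be a (s + d) y * G y - rk al be a s y * G y)); last first.
  by move=> y; rewrite mulrBl.
rewrite (IB (g1 _ sd0) (g1 _ s0)).
rewrite (I_ext (f := fun y => phi y * _) (g := fun y => phi y * drk al be a (s + d) y - phi y * drk al be a s y)); last first.
  by move=> y; rewrite mulrBr.
rewrite (IB (g2 _ sd0) (g2 _ s0)) => h.
have -> : I (fun y => rk al be a s y * G y) - - pi * I (fun y => phi y * drk al be a s y) =
  I (fun y => rk al be a (s + d) y * G y) + pi * I (fun y => phi y * drk al be a (s + d) y).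
  by lra.
rewrite (le_trans (ler_normD _ _)) //.
apply: (@le_trans _ _ (N / (s + d))).
  rewrite /N [leRHS]mulrDl lerD //.
    by rewrite (le_trans (b1 _ sd0)) // mulrAC.
  rewrite normrM (gtr0_norm pi0) -[leRHS]mulrA ler_wpM2l ?(ltW pi0) // (le_trans (b2 _ sd0)) //.
  by rewrite le_eqVlt; apply/orP; left; apply/eqP; ring.
rewrite ler_pdivrMr // mulrDr.
have -> : e * d = N + 1 by rewrite /d mulrC divfK // gt_eqF.
have : 0 <= e * s by rewrite mulr_ge0 // ltW.
by lra.
Qed.

End weak_formulation.

(** * The half-harmonic equation *)

Section liouville.
Context {R : realType}.
Notation mu := (@lebesgue_measure R).
Notation ig f := (mu.-integrable setT (EFin \o f)).
Notation I f := (Rintegral mu setT f).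
Implicit Types (a s t x y p q : R).

Lemma ig_sqr1V : ig (fun y => (y ^+ 2 + 1)^-1).
Proof.
apply: ig_ext (ig_pk 0 ltr01) => y.
by rewrite /pk sub0r sqrrN expr1n mul1r.
Qed.

Lemma I_sqr1V : I (fun y => (y ^+ 2 + 1)^-1) = pi.
Proof.
rewrite -(I_pk 0 ltr01); apply: I_ext => y.
by rewrite /pk sub0r sqrrN expr1n mul1r.
Qed.

Lemma sqr1_gt0 y : 0 < y ^+ 2 + 1.
Proof. by rewrite ltr_wpDl ?sqr_ge0. Qed.

(** Made for the centre q = 1 of the geodesic: the explicit solution is known for q < 1, while the
    derivative there is two-sided. *)
Lemma left_zero_derive (g : R -> R) x d : is_derive x (1 : R) g d ->
  (forall y, x - 1 < y -> y <= x -> g y = 0) -> d = 0.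
Proof.
move=> [dg <-] g0; rewrite /derive.
(* Starting at 1 / 2 keeps x + t_n strictly above x - 1. *)
pose t_ (n : nat) : R := - n.+2%:R^-1.
have ht : (forall n, t_ n != 0) /\ t_ n @[n --> \oo] --> (0 : R).
  split; first by move=> n; rewrite oppr_eq0 invr_eq0 pnatr_eq0.
  rewrite -oppr0; apply: cvgN.
  rewrite (cvg_shiftS (fun n : nat => n.+1%:R^-1 : R)); exact: cvg_harmonic.
have /cvgr_dnbhsP /(_ t_ ht) h := dg.
rewrite -(cvg_lim _ h) //; apply: lim_near_cst => //.
apply: nearW => n /=.
rewrite scaler1 (g0 x) //; last by rewrite ltrBlDr ltrDl.
rewrite subr0 g0 ?scaler0 //.
  by rewrite [ltRHS]addrC ltrD2l ltrN2 invf_lt1 // ltr1n.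
by rewrite gerDr oppr_le0 invr_ge0.
Qed.

(* [arc_pk p q] is the Poisson kernel at the point of parameter q of the geodesic from
   i (q = 1) to the boundary point p (q = 0); [arc_dpk] is its q-derivative. *)
Definition arc_den p q y : R := (y - p) ^+ 2 + (q * (1 + y * p)) ^+ 2.
Definition arc_pk p q y : R := q * (1 + p ^+ 2) / arc_den p q y.
Definition arc_dpk p q y : R :=
  (1 + p ^+ 2) * ((y - p) ^+ 2 - (q * (1 + y * p)) ^+ 2) / arc_den p q y ^+ 2.

(** At q = 1 the denominator factors as (1 + p^2) (y^2 + 1), by Lagrange's identity; for q >= l at
    most a factor l^2 is lost. This makes the majorants uniform in q. *)
Lemma arc_den_ge l p q y : 0 < l -> l <= 1 -> l <= q ->
  l ^+ 2 * ((1 + p ^+ 2) * (y ^+ 2 + 1)) <= arc_den p q y.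
Proof.
move=> l0 l1 lq.
have -> : (1 + p ^+ 2) * (y ^+ 2 + 1) = (y - p) ^+ 2 + (1 + y * p) ^+ 2 by ring.
rewrite /arc_den exprMn mulrDr lerD //.
  by rewrite ler_piMl ?sqr_ge0 // expr_le1 // ltW.
by rewrite ler_wpM2r ?sqr_ge0 // ler_pXn2r ?nnegrE ?(ltW l0) // (le_trans _ lq) // ltW.
Qed.

Lemma sqrp_gt0 p : 0 < 1 + p ^+ 2.
Proof. by rewrite ltr_pwDl ?sqr_ge0. Qed.

Lemma arc_den_gt0 p q y : 0 < q -> 0 < arc_den p q y.
Proof.
move=> q0; pose l := Num.min q 1.
have l0 : 0 < l by rewrite lt_min q0 /=.
have l1 : l <= 1 by rewrite ge_min lexx orbT.
have lq : l <= q by rewrite ge_min lexx.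
apply: lt_le_trans (arc_den_ge p y l0 l1 lq).
by rewrite !mulr_gt0 ?sqrp_gt0 ?sqr1_gt0.
Qed.

Lemma arc_pk_derive p q y : 0 < q ->
  is_derive q (1 : R) (fun q => arc_pk p q y) (arc_dpk p q y).
Proof.
move=> q0; have D0 := lt0r_neq0 (arc_den_gt0 p y q0).
have dq := der_id q; have dD := der_add (der_cst ((y - p) ^+ 2) q)
  (der_exp 2 (der_mul dq (der_cst (1 + y * p) q))).
apply: (is_derive_eq (der_mul (der_mul dq (der_cst (1 + p ^+ 2) q)) (der_inv dD D0))).
by rewrite /arc_dpk; move: D0; rewrite /arc_den /= => D0; field.
Qed.

Lemma arc_dpk_le l p q y : 0 < l -> l <= 1 -> l <= q ->
  `|arc_dpk p q y| <= (l ^+ 2)^-1 * (y ^+ 2 + 1)^-1.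
Proof.
move=> l0 l1 lq; have q0 := lt_le_trans l0 lq.
have D0 := arc_den_gt0 p y q0; have P0 := sqrp_gt0 p; have Y0 := sqr1_gt0 y.
apply: (@le_trans _ _ ((1 + p ^+ 2) / arc_den p q y)).
  rewrite /arc_dpk normrM normfV (gtr0_norm (exprn_gt0 2 D0)) ler_pdivrMr ?exprn_gt0 //.
  have -> : (1 + p ^+ 2) / arc_den p q y * arc_den p q y ^+ 2 = (1 + p ^+ 2) * arc_den p q y.
    by field; exact: lt0r_neq0.
  rewrite normrM (gtr0_norm P0) ler_pM2l // (le_trans (ler_normB _ _)) //.
  by rewrite /arc_den !ger0_norm ?sqr_ge0.
rewrite ler_pdivrMr //.
have := arc_den_ge p y l0 l1 lq; rewrite -invfM ler_pdivlMl ?mulr_gt0 ?exprn_gt0 //.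
by move=> h; apply: le_trans h; rewrite mulrAC mulrA; rewrite le_eqVlt; apply/orP; left; apply/eqP; ring.
Qed.

Variables (phi : R -> R) (K : R).
Hypothesis mphi : measurable_fun setT phi.
Hypothesis phiK : forall x, `|phi x| <= K.

Local Notation u := (pext phi).

(** The value of u at the point i, that is, pi times the mean of phi over the circle. *)
Let c := I (fun y => phi y * (y ^+ 2 + 1)^-1).
Let G x := 2 / (x ^+ 2 + 1) * (pi * phi x - c).

Hypothesis phiG : forall x, PV_at (hl_kernel phi x) x (G x).

Let K0 : 0 <= K := bound_ge0 phiK.
Let pi0 : 0 < pi :> R := pi_gt0 R.

Let G_le x : `|pi * phi x - c| <= pi * K + `|c|.
Proof.
rewrite (le_trans (ler_normB _ _)) // lerD2r normrM gtr0_norm //.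
by rewrite ler_wpM2l // ltW.
Qed.

Let mGphi : measurable_fun setT (fun x => pi * phi x - c).
Proof. by apply: measurable_funB => //; exact: measurable_funM. Qed.

Let ig_G : ig G.
Proof.
apply: ig_ext (igZ 2 (igM_bounded mGphi G_le ig_sqr1V)) => y.
by rewrite /G; ring.
Qed.

Let I_G : I G = 0.
Proof.
have g1 := igM_bounded mphi phiK ig_sqr1V.
rewrite (I_ext (g := fun y => (2 * pi) * (phi y * (y ^+ 2 + 1)^-1) - (2 * c) * (y ^+ 2 + 1)^-1)); last first.
  by move=> y; rewrite /G; ring.
rewrite (IB (igZ _ g1) (igZ _ ig_sqr1V)) (IZ _ g1) (IZ _ ig_sqr1V) I_sqr1V -/c.
by ring.
Qed.

Let normal_bound : exists2 B, 0 <= B & forall x t, 0 < t -> `|pi * phi x - u x t| <= B * t.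
Proof.
apply: (@pext_normal_bound R phi G K (2 * (pi * K + `|c|))) => // x.
rewrite /G normrM; apply: ler_pM => //.
rewrite normrM normfV (gtr0_norm (sqr1_gt0 x)) ger0_norm // ler_pdivrMr ?sqr1_gt0 //.
by rewrite ler_peMr // lerDr sqr_ge0.
Qed.

(* The parameters are chosen so that s + rk y = (1 + y^2) pk s (y - a), which cancels
   the weight 1 / (1 + y^2) of G; the added constant costs nothing since I G = 0. *)
Lemma pext_identity a s : 0 < s ->
  2 * (u a s - c) = - I (fun y => phi y * drk (2 * a * s) (1 + a ^+ 2 - s ^+ 2) a s y).
Proof.
move=> s0; have [B B0 hB] := normal_bound.
have h := weak_rk mphi phiK (@phiG) hB ig_G (2 * a * s) (1 + a ^+ 2 - s ^+ 2) a s0.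
apply: (mulfI (lt0r_neq0 pi0)); rewrite mulrN -mulNr -h.
have g1 : ig (fun y => rk (2 * a * s) (1 + a ^+ 2 - s ^+ 2) a s y * G y).
  by apply: igM_bounded (measurable_rk _ _ a s) _ ig_G => y; exact: rk_le.
have g2 := ig_phi mphi phiK (ig_pk a s0); have g3 := ig_pk a s0.
have -> : I (fun y => rk (2 * a * s) (1 + a ^+ 2 - s ^+ 2) a s y * G y) =
   I (fun y => s * G y + rk (2 * a * s) (1 + a ^+ 2 - s ^+ 2) a s y * G y).
  by rewrite (ID (igZ s ig_G) g1) (IZ _ ig_G) I_G mulr0 add0r.
rewrite (I_ext (g := fun y => 2 * pi * (phi y * pk s (a - y)) - 2 * c * pk s (a - y))).
  by rewrite (IB (igZ _ g2) (igZ _ g3)) (IZ _ g2) (IZ _ g3) I_pk // -/(u a s); ring.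
move=> y; rewrite pk_sym /rk /G /pk; field.
by rewrite !gt_eqF ?sqr_add_gt0 ?sqr1_gt0.
Qed.

Variable p : R.
Let U q := I (fun y => phi y * arc_pk p q y).
Let dU q := I (fun y => phi y * arc_dpk p q y).
Let A q := 1 + (q * p) ^+ 2.
(** [ctr q] + i [rad q] is the image of i q under the hyperbolic rotation z -> (z + p) / (1 - p z),
    which fixes i and sends 0 to p. *)
Let ctr q := p * (1 - q ^+ 2) / A q.
Let rad q := q * (1 + p ^+ 2) / A q.

Let A_gt0 q : 0 < A q.
Proof. by rewrite /A ltr_pwDl // sqr_ge0. Qed.

Let rad_gt0 q : 0 < q -> 0 < rad q.
Proof. by move=> q0; rewrite divr_gt0 ?mulr_gt0 ?sqrp_gt0 ?A_gt0. Qed.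

Lemma arc_den_pk q y : arc_den p q y = A q * ((y - ctr q) ^+ 2 + rad q ^+ 2).
Proof.
rewrite /arc_den /ctr /rad; have := A_gt0 q; rewrite /A => h.
by field; exact: lt0r_neq0.
Qed.

Lemma arc_pkE q y : 0 < q -> arc_pk p q y = pk (rad q) (ctr q - y).
Proof.
move=> q0; rewrite /arc_pk arc_den_pk pk_sym /pk.
have -> : q * (1 + p ^+ 2) = A q * rad q by rewrite /rad [RHS]mulrC divfK // gt_eqF // A_gt0.
by rewrite -mulf_div divff ?mul1r // gt_eqF // A_gt0.
Qed.

(** These are the parameters of [pext_identity] at ([ctr q], [rad q]): the test function there is
    the derivative of the Poisson kernel along the geodesic, up to 1 - q^2. *)
Lemma arc_dpkE q y : 0 < q -> (1 - q ^+ 2) * arc_dpk p q y =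
  drk (2 * ctr q * rad q) (1 + ctr q ^+ 2 - rad q ^+ 2) (ctr q) (rad q) y.
Proof.
move=> q0; have D0 := arc_den_gt0 p y q0; have A0 := A_gt0 q.
rewrite /drk; have -> : (y - ctr q) ^+ 2 + rad q ^+ 2 = arc_den p q y / A q.
  by rewrite arc_den_pk mulrC mulKf // gt_eqF.
rewrite /arc_dpk /ctr /rad; move: (gt_eqF D0) (gt_eqF A0) => D1; rewrite /A => A1.
move: D1; move: (arc_den p q y) => D D1.
by field; rewrite D1 A1.
Qed.

Let UE q : 0 < q -> U q = u (ctr q) (rad q).
Proof. by move=> q0; apply: I_ext => y; rewrite arc_pkE. Qed.

(** With r = (1 - q) / (1 + q) one has (1 - q^2) d/dq = - 2 r d/dr, so this is r dU/dr = U - c. *)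
Let ode q : 0 < q -> (1 - q ^+ 2) * dU q = - (2 * (U q - c)).
Proof.
move=> q0; rewrite UE // pext_identity ?rad_gt0 // opprK -IZ.
  by apply: I_ext => y; rewrite mulrCA arc_dpkE.
pose l := Num.min q 1.
have l0 : 0 < l by rewrite lt_min q0 /=.
have l1 : l <= 1 by rewrite ge_min lexx orbT.
have lq : l <= q by rewrite ge_min lexx.
have hm : measurable_fun setT (arc_dpk p q).
  have ma : measurable_fun setT (fun y : R => (y - p) ^+ 2).
    by apply: measurable_funX; exact: measurable_funB.
  have mb : measurable_fun setT (fun y : R => (q * (1 + y * p)) ^+ 2).
    apply: measurable_funX; apply: measurable_funM => //.
    by apply: measurable_funD => //; exact: measurable_funM.
  apply: measurable_funM; first by apply: measurable_funM => //; exact: measurable_funB.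
  apply: measurableT_comp; first exact: measurable_invr.
  by apply: measurable_funX; exact: measurable_funD.
apply: (ig_phi mphi phiK); apply: ig_le hm (igZ (l ^+ 2)^-1 ig_sqr1V) _ => y.
exact: arc_dpk_le.
Qed.

Let U_derive q : 0 < q -> is_derive q (1 : R) U (dU q).
Proof.
(* Differentiation under the integral takes place on []l, q + 1[]; for q = 1 this interval surrounds
   1, so the derivative at the centre is two-sided. *)
move=> q0; pose l := Num.min (q / 2) 1.
have l0 : 0 < l by rewrite lt_min divr_gt0 /=.
have l1 : l <= 1 by rewrite ge_min lexx orbT.
have lq : l < q by rewrite gt_min; apply/orP; left; lra.
pose f q y := phi y * arc_pk p q y.
have df (r y : R) : 0 < r -> is_derive r (1 : R) (f ^~ y) (phi y * arc_dpk p r y).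
  move=> r0; apply: (is_derive_eq (der_mul (der_cst (phi y) r) (arc_pk_derive p y r0))).
  by rewrite mul0r add0r.
have e (r y : R) : 0 < r -> partial1of2 f r y = phi y * arc_dpk p r y.
  by move=> r0; rewrite partial1of2E; have [_ ->] := df r y r0.
have Iq : (`]l, (q + 1)[%classic : set R) q by rewrite /= in_itv /= lq /=; lra.
have c1 x : (`]l, (q + 1)[%classic : set R) x -> mu.-integrable setT (EFin \o f x).
  rewrite /= in_itv /= => /andP[lx _]; have x0 := lt_trans l0 lx.
  apply: (ig_phi mphi phiK); apply: ig_ext (ig_pk (ctr x) (rad_gt0 x0)) => y.
  by rewrite arc_pkE.
have c2 x y : (`]l, (q + 1)[%classic : set R) x -> setT y -> derivable (f ^~ y) x 1.
  rewrite /= in_itv /= => /andP[lx _] _; have x0 := lt_trans l0 lx.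
  by have [] := df x y x0.
pose g y := K * ((l ^+ 2)^-1 * (y ^+ 2 + 1)^-1).
have g0 y : 0 <= g y.
  by apply: mulr_ge0 => //; apply: mulr_ge0; rewrite invr_ge0 ?sqr_ge0 // ltW // sqr1_gt0.
have ig_g : mu.-integrable setT (EFin \o g) by exact/igZ/igZ/ig_sqr1V.
have c3 x y : (`]l, (q + 1)[%classic : set R) x -> setT y -> `|partial1of2 f x y| <= g y.
  rewrite /= in_itv /= => /andP[lx _] _; have x0 := lt_trans l0 lx.
  by rewrite e // normrM ler_pM // arc_dpk_le // ltW.
have d1 := derivable_under_integral measurableT Iq c1 c2 g0 ig_g c3.
have d2 := differentiation_under_integral measurableT Iq c1 c2 g0 ig_g c3.
apply: DeriveDef; first exact: d1.
rewrite -derive1E [LHS]d2; apply: I_ext => y; exact: e.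
Qed.

Lemma arc_constant : exists k, forall q, 0 < q -> q < 1 -> U q = c + k * (1 - q) / (1 + q).
Proof.
pose Y q := (U q - c) * (1 + q) * (1 - q)^-1.
have dY q : 0 < q -> q < 1 -> is_derive q (1 : R) Y 0.
  move=> q0 q1; have h1 : 1 - q != 0 by rewrite gt_eqF // subr_gt0.
  apply: (is_derive_eq (der_mul (der_mul
    (der_add (U_derive q0) (der_cst (- c) q)) (der_add (der_cst 1 q) (der_id q)))
    (der_inv (der_add (der_cst 1 q) (der_opp (der_id q))) h1))).
  have h2 := ode q0.
  have -> : (((dU q + 0) * (1 + q) + (U q - c) * (0 + 1)) / (1 - q) +
      (U q - c) * (1 + q) * (- (0 - 1) / (1 - q) ^+ 2)) =
      ((1 - q ^+ 2) * dU q + 2 * (U q - c)) / (1 - q) ^+ 2 by field.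
  by rewrite h2 addNr mul0r.
have Yc q r : 0 < q -> q < r -> r < 1 -> Y q = Y r.
  move=> q0 qr r1.
  have hd z : z \in `]q, r[ -> is_derive z (1 : R) Y ((fun=> 0) z).
    by rewrite in_itv /= => /andP[qz zr]; apply: dY; [exact: lt_trans qz|exact: lt_trans r1].
  have cY : {within `[q, r], continuous Y}.
    apply: derivable_within_continuous => z; rewrite in_itv /= => /andP[qz zr].
    by have [] := dY z (lt_le_trans q0 qz) (le_lt_trans zr r1).
  have [z _] := MVT qr hd cY.
  by rewrite mul0r => /eqP; rewrite subr_eq0 => /eqP.
exists (Y 2^-1) => q q0 q1.
have -> : Y 2^-1 = Y q.
  have h0 : 0 < 2^-1 :> R by rewrite invr_gt0.
  have h1 : 2^-1 < 1 :> R by rewrite invf_lt1 // ltr1n.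
  by case: (ltgtP q 2^-1) => [h|h|->] //; [symmetry; exact: Yc|exact: Yc].
rewrite /Y; field.
by rewrite gt_eqF ?addr_gt0 // gt_eqF // subr_gt0.
Qed.

Lemma arc_limit : pi * phi p = c - 2 * dU 1.
Proof.
have [k hk] := arc_constant; have [B B0 hB] := normal_bound.
have U1 : U 1 = c.
  apply: I_ext => y; congr (_ * _); rewrite /arc_pk /arc_den.
  have -> : (y - p) ^+ 2 + (1 * (1 + y * p)) ^+ 2 = (1 + p ^+ 2) * (y ^+ 2 + 1) by ring.
  by field; rewrite !gt_eqF ?sqr1_gt0 ?sqrp_gt0.
(* The slope of (1 - q) / (1 + q) at q = 1 is - 1 / 2. *)
have dU1 : dU 1 + k / 2 = 0.
  have h2 : (1 : R) + 1 != 0 by rewrite gt_eqF.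
  apply: (@left_zero_derive (fun q => U q - c - k * (1 - q) * (1 + q)^-1) 1).
    apply: (is_derive_eq (der_add (der_add (U_derive ltr01) (der_cst (- c) 1))
      (der_opp (der_mul (der_mul (der_cst k 1) (der_add (der_cst 1 1) (der_opp (der_id 1))))
         (der_inv (der_add (der_cst 1 1) (der_id 1)) h2))))).
    by field.
  move=> q; rewrite subrr => q0; rewrite le_eqVlt => /predU1P[->|q1].
    by rewrite U1 !subrr mulr0 mul0r subrr.
  by rewrite hk //; ring.
have -> : dU 1 = - k / 2 by lra.
have -> : c - 2 * (- k / 2) = c + k by field.
(* Three errors of order q: the horizontal move from [ctr q] to p, equal to |p| q [rad q] because
   the geodesic meets the boundary orthogonally, which beats the Lipschitz constant K pi / [rad q];
   the vertical approach to phi p; and (1 - q) / (1 + q) against 1. *)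
pose M := K * pi * `|p| + B * (1 + p ^+ 2) + 2 * `|k|.
have M0 : 0 <= M.
  by rewrite !addr_ge0 ?mulr_ge0 ?(ltW pi0) // ltW // sqrp_gt0.
have key q : 0 < q -> q < 1 -> `|pi * phi p - (c + k)| <= M * q.
  move=> q0 q1; have r0 := rad_gt0 q0; have A0 := A_gt0 q.
  have h1 : `|U q - u p (rad q)| <= K * pi * `|p| * q.
    rewrite UE // (le_trans (pext_lip_space mphi phiK _ _ r0)) //.
    have -> : ctr q - p = - (p * q * rad q).
      by rewrite /ctr /rad; move: A0; rewrite /A => A0; by field; exact: lt0r_neq0.
    rewrite normrN normrM (gtr0_norm r0) mulfK ?(gt_eqF r0) // normrM (gtr0_norm q0).
    by rewrite mulrA.
  have h2 : `|pi * phi p - u p (rad q)| <= B * (1 + p ^+ 2) * q.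
    rewrite (le_trans (hB p _ r0)) // -mulrA ler_wpM2l // /rad ler_pdivrMr // [q * _]mulrC.
    by rewrite ler_peMr ?mulr_ge0 ?(ltW q0) ?(ltW (sqrp_gt0 p)) // /A lerDl sqr_ge0.
  have h3 : `|U q - (c + k)| <= 2 * `|k| * q.
    rewrite hk //; have -> : c + k * (1 - q) / (1 + q) - (c + k) = - (k * (2 * q / (1 + q))).
      by field; rewrite gt_eqF // addr_gt0.
    have q10 : 0 < 1 + q by rewrite addr_gt0.
    rewrite (_ : 2 * `|k| * q = `|k| * (2 * q)); last by ring.
    rewrite normrN normrM ler_wpM2l //.
    rewrite ger0_norm ?divr_ge0 ?mulr_ge0 ?(ltW q0) ?(ltW q10) // ler_pdivrMr //.
    by rewrite ler_peMr ?mulr_ge0 ?(ltW q0) // lerDl ltW.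
  have -> : pi * phi p - (c + k) = (pi * phi p - u p (rad q)) - (U q - u p (rad q)) + (U q - (c + k)) by ring.
  have -> : M * q = (B * (1 + p ^+ 2) * q + K * pi * `|p| * q) + 2 * `|k| * q.
    by rewrite /M; ring.
  apply: (le_trans (ler_normD _ _)); apply: lerD => //.
  by apply: (le_trans (ler_normB _ _)); exact: lerD.
apply/eqP; rewrite -subr_eq0 -normr_le0; apply/ler_addgt0Pl => e e0; rewrite addr0.
have M1 : 0 < M + 1 by rewrite ltr_wpDl.
pose q := Num.min 2^-1 (e / (M + 1)).
have q0 : 0 < q by rewrite lt_min invr_gt0 divr_gt0 //= ltr0n.
have q1 : q < 1 by rewrite gt_min invf_lt1 // ltr1n.
apply: (le_trans (key q q0 q1)).
have : q <= e / (M + 1) by rewrite ge_min lexx orbT.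
by rewrite ler_pdivlMr //; lra.
Qed.

End liouville.

(** * Explicit form of the solutions *)

Section liouville_conclusion.
Context {R : realType}.
Notation mu := (@lebesgue_measure R).
Notation I f := (Rintegral mu setT f).

Lemma half_harmonic_liouville (phi : R -> R) (K c : R) :
  measurable_fun setT phi -> (forall x, `|phi x| <= K) ->
  c = I (fun y => phi y * (y ^+ 2 + 1)^-1) ->
  (forall x, PV_at (hl_kernel phi x) x (2 / (x ^+ 2 + 1) * (pi * phi x - c))) ->
  exists b0 b1 b2 : R, forall x, phi x = b0 + (b1 * (1 - x ^+ 2) + b2 * x) / (x ^+ 2 + 1).
Proof.
move=> mphi phiK -> phiG; set c0 := I _ in phiG.
(* [m1] and 2 [m2] are the vertical and horizontal derivatives of u at i. They enter through (y -
   p)^2 - (1 + y p)^2 = (y^2 - 1) (1 - p^2) - 4 y p. *)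
pose m1 := I (fun y => phi y * ((y ^+ 2 - 1) / (y ^+ 2 + 1) ^+ 2)).
pose m2 := I (fun y => phi y * (y / (y ^+ 2 + 1) ^+ 2)).
have pi0 : 0 < pi :> R := pi_gt0 R.
exists (c0 / pi), (- 2 * m1 / pi), (8 * m2 / pi) => p.
have h := arc_limit mphi phiK phiG p.
have hm (f : R -> R) : measurable_fun setT f -> measurable_fun setT (fun y => f y / (y ^+ 2 + 1) ^+ 2).
  move=> mf; apply: measurable_funM => //; apply: measurableT_comp; first exact: measurable_invr.
  by apply: measurable_funX; apply: measurable_funD => //; exact: measurable_funX.
have g1 : mu.-integrable setT (EFin \o (fun y : R => phi y * ((y ^+ 2 - 1) / (y ^+ 2 + 1) ^+ 2))).
  apply: (ig_phi mphi phiK); apply: ig_le (hm _ _) ig_sqr1V _.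
    by apply: measurable_funB => //; exact: measurable_funX.
  move=> y; have Y0 := sqr1_gt0 y.
  rewrite normrM normfV (gtr0_norm (exprn_gt0 2 Y0)) ler_pdivrMr ?exprn_gt0 //.
  rewrite expr2 mulrA mulVf ?gt_eqF // mul1r ler_norml.
  by have := sqr_ge0 y; move=> ?; apply/andP; split; lra.
have g2 : mu.-integrable setT (EFin \o (fun y : R => phi y * (y / (y ^+ 2 + 1) ^+ 2))).
  apply: (ig_phi mphi phiK); apply: ig_le (hm _ _) ig_sqr1V _ => //.
  move=> y; have Y0 := sqr1_gt0 y.
  rewrite normrM normfV (gtr0_norm (exprn_gt0 2 Y0)) ler_pdivrMr ?exprn_gt0 //.
  rewrite expr2 mulrA mulVf ?gt_eqF // mul1r ler_norml.
  have := sqr_ge0 (y - 1); have := sqr_ge0 (y + 1); have := sqr_ge0 y.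
  by rewrite !expr2 => *; apply/andP; split; lra.
have e : I (fun y => phi y * arc_dpk p 1 y) = ((1 - p ^+ 2) * m1 - 4 * p * m2) / (1 + p ^+ 2).
  rewrite (I_ext (g := fun y => (1 - p ^+ 2) / (1 + p ^+ 2) * (phi y * ((y ^+ 2 - 1) / (y ^+ 2 + 1) ^+ 2)) -
     4 * p / (1 + p ^+ 2) * (phi y * (y / (y ^+ 2 + 1) ^+ 2)))).
    rewrite (IB (igZ _ g1) (igZ _ g2)) (IZ _ g1) (IZ _ g2) -/m1 -/m2.
    by field; rewrite gt_eqF // sqrp_gt0.
  move=> y; rewrite /arc_dpk /arc_den.
  have -> : (y - p) ^+ 2 + (1 * (1 + y * p)) ^+ 2 = (1 + p ^+ 2) * (y ^+ 2 + 1) by ring.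
  by field; rewrite !gt_eqF ?sqr1_gt0 ?sqrp_gt0.
have {}h : pi * phi p = c0 - 2 * (((1 - p ^+ 2) * m1 - 4 * p * m2) / (1 + p ^+ 2)).
  by rewrite -e.
apply: (mulfI (lt0r_neq0 pi0)); rewrite h.
have P0 := gt_eqF (sqr1_gt0 p).
rewrite [1 + p ^+ 2]addrC; move: (pi : R) pi0 => P /lt0r_neq0 PP.
by field; rewrite P0 PP.
Qed.

End liouville_conclusion.

(** * The linearized equation *)

Section reduction.
Context {R : realType}.
Notation mu := (@lebesgue_measure R).
Notation ig f := (mu.-integrable setT (EFin \o f)).
Notation I f := (Rintegral mu setT f).
Implicit Types (x y e : R).

(** U is an inverse stereographic projection, with squared chordal distance 4 (x - y)^2 / ((1 + x^2)
    (1 + y^2)); the singularity cancels. *)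
Lemma I_energy_density x : I (energy_density x) = 4 * pi / (x ^+ 2 + 1).
Proof.
have g1 := @ig_sqr1V R.
have e y : y != x -> energy_density x y = 4 / (x ^+ 2 + 1) * (y ^+ 2 + 1)^-1.
  move=> yx; rewrite /energy_density /U1 /U2; field.
  by rewrite (gt_eqF (sqr1_gt0 y)) (gt_eqF (sqr1_gt0 x)) subr_eq0 eq_sym yx.
have mU1 : measurable_fun setT (@U1 R).
  apply: measurable_funM; first by apply: measurable_funB => //; exact: measurable_funX.
  exact: ig_measurable (@ig_sqr1V R).
have mU2 : measurable_fun setT (@U2 R).
  apply: measurable_funM; first exact: measurable_funM.
  exact: ig_measurable (@ig_sqr1V R).
rewrite (@I_ext_except _ x _ (fun y => 4 / (x ^+ 2 + 1) * (y ^+ 2 + 1)^-1)) //.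
- by rewrite (IZ _ g1) I_sqr1V; ring.
- apply: measurable_funM.
    by apply: measurable_funD; apply: measurable_funX; exact: measurable_funB.
  apply: measurableT_comp; first exact: measurable_invr.
  by apply: measurable_funX; exact: measurable_funB.
- exact: ig_measurable (igZ _ g1).
Qed.

(** Writes an absolutely convergent integral as a limit of truncations, so that it can be combined
    with principal values at each fixed e. *)
Lemma I_punctured_cvg (f : R -> R) x : ig f ->
  I (fun y => if (0 < e) && (e < `|x - y|) then f y else 0) @[e --> 0^'+] --> I f.
Proof.
move=> hf; have mf := ig_measurable hf.
have mcut e : measurable_fun setT (fun y => if (0 < e) && (e < `|x - y|) then f y else 0).
  apply: measurable_fun_ifT => //; apply: measurable_and => //.
  apply: measurable_fun_ltr => //.
  by apply: measurableT_comp => //; exact: measurable_funB.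
apply/cvg_at_rightP => e_ [e0 ecvg].
have [||||h1 h2] := @dominated_cvgR R
  (fun n y => if (0 < e_ n) && (e_ n < `|x - y|) then f y else 0)
  (fun y => if y == x then 0 else f y) (fun y => `|f y|).
- by move=> n; exact: mcut.
- move=> y; apply: cvg_near_cst; case: eqVneq => [->|yx].
    by apply: nearW => n; rewrite subrr normr0 [e_ n < 0]ltNge ltW //= andbF.
  have d0 : 0 < `|x - y| by rewrite normr_gt0 subr_eq0 eq_sym.
  near=> n; rewrite e0 /=; suff -> : e_ n < `|x - y| by [].
  near: n; exact: (cvgr_lt (0 : R)).
- exact: ig_norm.
- by move=> n y; case: ifP => // _; rewrite normr0.
rewrite (@I_ext_except _ x f (fun y => if y == x then 0 else f y)) //.
- exact: ig_measurable h1.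
- by move=> y /negPf ->.
Unshelve. all: by end_near. Qed.

(** Z_1(x) . (v(x) - v(y)) = phi(x) - phi(y) + phi(y) (1 - Z_1(x) . Z_1(y)), and the last bracket is
    2 (x - y)^2 / ((1 + x^2) (1 + y^2)). It cancels the kernel and leaves the nonlocal term with
    c. *)
Lemma PV_tangential (v1 v2 : R -> R) (K x L1 L2 : R) :
  let phi y := v1 y * Z11 y + v2 y * Z12 y in
  let c := I (fun y => phi y * (y ^+ 2 + 1)^-1) in
  measurable_fun setT v1 -> measurable_fun setT v2 -> measurable_fun setT phi ->
  (forall y, `|v1 y| <= K) -> (forall y, `|v2 y| <= K) -> (forall y, `|phi y| <= 2 * K) ->
  (forall y, v1 y = phi y * Z11 y) -> (forall y, v2 y = phi y * Z12 y) ->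
  PV_at (hl_kernel v1 x) x L1 -> PV_at (hl_kernel v2 x) x L2 ->
  PV_at (hl_kernel phi x) x (Z11 x * L1 + Z12 x * L2 - 2 / (x ^+ 2 + 1) * c).
Proof.
move=> phi c mv1 mv2 mphi b1 b2 bphi e1 e2 h1 h2.
have g := igM_bounded mphi bphi (@ig_sqr1V R).
pose r y := 2 / (x ^+ 2 + 1) * (phi y * (y ^+ 2 + 1)^-1).
have ig_r : ig r := igZ (2 / (x ^+ 2 + 1)) g.
have I_r : I r = 2 / (x ^+ 2 + 1) * c by rewrite /r (IZ _ g).
rewrite /PV_at -I_r.
apply: cvg_trans (cvgB (cvgD (cvgM (cvg_cst (Z11 x)) h1) (cvgM (cvg_cst (Z12 x)) h2))
  (I_punctured_cvg x ig_r)).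
apply: near_eq_cvg; near=> e.
have e0 : 0 < e by near: e; exact: nbhs_right_gt.
have f1 := ig_far mv1 b1 x e0; have f2 := ig_far mv2 b2 x e0.
have f3 : ig (fun y => if (0 < e) && (e < `|x - y|) then r y else 0).
  apply: ig_le (ig_norm ig_r) _; last first.
    by move=> y; case: ifP => // _; rewrite normr0.
  apply: measurable_fun_ifT => //; last exact: ig_measurable ig_r.
  apply: measurable_and => //; apply: measurable_fun_ltr => //.
  by apply: measurableT_comp => //; exact: measurable_funB.
change (Z11 x * trunc_int (hl_kernel v1 x) x e + Z12 x * trunc_int (hl_kernel v2 x) x e
  - I (fun y => if (0 < e) && (e < `|x - y|) then r y else 0) = trunc_int (hl_kernel phi x) x e).
rewrite !trunc_far //.
rewrite -(IZ _ f1) -(IZ _ f2) -(ID (igZ _ f1) (igZ _ f2)) -(IB (igD (igZ _ f1) (igZ _ f2)) f3).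
apply: I_ext => y; rewrite e0 /=; case: ifPn => [ey|_]; last by rewrite !mulr0 addr0 subrr.
have xy : x - y != 0 by rewrite -normr_gt0 (lt_trans e0).
have k1 : phi x = phi x * (Z11 x * Z11 x + Z12 x * Z12 x).
  rewrite -[LHS]mulr1; congr (_ * _); rewrite /Z11 /Z12; field.
  by rewrite gt_eqF // sqr1_gt0.
rewrite /hl_kernel (e1 x) (e1 y) (e2 x) (e2 y) /r.
move: (phi x) (phi y) => px py.
rewrite /Z11 /Z12; field.
by rewrite xy (gt_eqF (sqr1_gt0 y)) (gt_eqF (sqr1_gt0 x)).
Unshelve. all: by end_near. Qed.

End reduction.

Unset Implicit Arguments.

Theorem theorem1p1 (R : realType) (v1 v2 : R -> R) :
  measurable_fun setT v1 -> measurable_fun setT v2 ->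
  (exists K : R, forall x : R, `|v1 x| <= K /\ `|v2 x| <= K) ->
  (forall x : R, v1 x * U1 x + v2 x * U2 x = 0) ->
  (forall x : R, solves_linearized_at v1 v2 x) ->
  exists c1 c2 c3 : R, forall x : R,
    v1 x = c1 * Z11 x + c2 * Z21 x + c3 * Z31 x /\
    v2 x = c1 * Z12 x + c2 * Z22 x + c3 * Z32 x.
Proof.
move=> mv1 mv2 [K hK] tang sol.
have b1 x : `|v1 x| <= K by case: (hK x).
have b2 x : `|v2 x| <= K by case: (hK x).
pose phi y := v1 y * Z11 y + v2 y * Z12 y.
have unit (x : R) : Z11 x ^+ 2 + Z12 x ^+ 2 = 1.
  by rewrite /Z11 /Z12; field; rewrite gt_eqF // sqr1_gt0.
(* Z_1 = (- U2, U1) is U turned by a right angle, so orthogonality to U is parallelism with Z_1. *)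
have tang' x : v1 x * Z12 x = v2 x * Z11 x.
  have := tang x; rewrite /U1 /U2 /Z11 /Z12 mulNr mulNr mulrN => /eqP.
  by rewrite subr_eq0 => /eqP.
have e1 x : v1 x = phi x * Z11 x.
  transitivity (v1 x * (Z11 x ^+ 2 + Z12 x ^+ 2)); first by rewrite unit mulr1.
  by rewrite /phi mulrDl mulrDr [v2 x * _ * _]mulrAC -tang'; ring.
have e2 x : v2 x = phi x * Z12 x.
  transitivity (v2 x * (Z11 x ^+ 2 + Z12 x ^+ 2)); first by rewrite unit mulr1.
  by rewrite /phi mulrDl mulrDr [v1 x * _ * _]mulrAC tang'; ring.
have mZ1 : measurable_fun setT (@Z11 R).
  apply: measurable_funM; first exact: measurable_funM.
  exact: ig_measurable (@ig_sqr1V R).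
have mZ2 : measurable_fun setT (@Z12 R).
  apply: measurable_funM; first by apply: measurable_funB => //; exact: measurable_funX.
  exact: ig_measurable (@ig_sqr1V R).
have mphi : measurable_fun setT phi.
  by apply: measurable_funD; exact: measurable_funM.
have bZ1 (x : R) : `|Z11 x| <= 1.
  rewrite -(@expr_le1 _ 2) // -normrX ger0_norm ?sqr_ge0 // -(unit x).
  by rewrite lerDl sqr_ge0.
have bZ2 (x : R) : `|Z12 x| <= 1.
  rewrite -(@expr_le1 _ 2) // -normrX ger0_norm ?sqr_ge0 // -(unit x).
  by rewrite lerDr sqr_ge0.
have bphi x : `|phi x| <= 2 * K.
  rewrite /phi (le_trans (ler_normD _ _)) // (normrM (v1 x)) (normrM (v2 x)) mulr_natl mulr2n.
  by rewrite lerD // -[leRHS]mulr1 ler_pM.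
pose c := Rintegral (@lebesgue_measure R) setT (fun y => phi y * (y ^+ 2 + 1)^-1).
have phiG x : PV_at (hl_kernel phi x) x (2 / (x ^+ 2 + 1) * (pi * phi x - c)).
  have [L1 [L2 [M [h1 h2 _ h3 h4]]]] := sol x.
  have pi0 : pi != 0 :> R := lt0r_neq0 (pi_gt0 R).
  have h := PV_tangential mv1 mv2 mphi b1 b2 bphi e1 e2 h1 h2.
  suff -> : 2 / (x ^+ 2 + 1) * (pi * phi x - c) = Z11 x * L1 + Z12 x * L2 - 2 / (x ^+ 2 + 1) * c by [].
  move: h3 h4; rewrite I_energy_density => h3 h4.
  have k1 : L1 = 2 * pi / (x ^+ 2 + 1) * v1 x + M * U1 x.
    rewrite -[LHS](divfK pi0) h3; move: (pi : R) pi0 => P P0; field.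
    by rewrite P0 gt_eqF // sqr1_gt0.
  have k2 : L2 = 2 * pi / (x ^+ 2 + 1) * v2 x + M * U2 x.
    rewrite -[LHS](divfK pi0) h4; move: (pi : R) pi0 => P P0; field.
    by rewrite P0 gt_eqF // sqr1_gt0.
  (* Taking the product with Z_1(x) cancels the M terms, since U(x) is orthogonal to it. *)
  rewrite k1 k2 [in LHS]/phi /U1 /U2 /Z11 /Z12; field.
  by rewrite gt_eqF // sqr1_gt0.
have [a0 [a1 [a2 h]]] := half_harmonic_liouville mphi bphi (erefl c) phiG.
(* Z_2 = - 2 / (x^2 + 1) Z_1 and Z_3 = - 2 x / (x^2 + 1) Z_1, while (1 - x^2) / (x^2 + 1) = 2 / (x^2
   + 1) - 1. *)
exists (a0 - a1), (- a1), (- a2 / 2) => x.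
rewrite e1 e2 h /Z11 /Z12 /Z21 /Z22 /Z31 /Z32; have x0 := sqr1_gt0 x.
by split; field; rewrite gt_eqF.
Qed.
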